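(* Let $f:\mathbb{D}\to\mathbb{C}$ be a normalized starlike mapping. Then $$|P_f(z)-z|\ge\frac{1-|z|^2}{2+|z|}\qquad\text{for all } z\in\mathbb{D}.$$ Equality occurs for some $z\in\mathbb{D}$ if and only if $f$ is a suitable rotation of the Koebe function, i.e. $f(z)=\dfrac{z}{(1-e^{i\theta}z)^2}$ for some $\theta\in\mathbb{R}$.
   Context: $\mathbb{D}=\{z\in\mathbb{C}:|z|<1\}$. A normalized starlike mapping is a univalent analytic function $f$ in $\mathbb{D}$ with $f(0)=0$, $f'(0)=1$, whose image is starlike with respect to $0$; equivalently $\operatorname{Re}\{z f'(z)/f(z)\}>0$ for all $z\in\mathbb{D}$ (the value at $z=0$ being $1$). The pole function is $P_f(z)=z+2\,f'(z)/f''(z)\in\mathbb{C}\cup\{\infty\}$, with $P_f(z)=\infty$ when $f''(z)=0$; for $c\in\mathbb{C}$, $|\infty-c|=+\infty$. *)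

(* Defs.v *)
From Stdlib Require Import Reals.
From Coquelicot Require Import Coquelicot.

Open Scope R_scope.

Definition in_disk (z : C) : Prop := Cmod z < 1.

(* Only the values of f near z matter: a function C -> C may be arbitrary
   outside the open set on which it is required to be analytic. *)
Definition analytic_at (f : C -> C) (z : C) : Prop :=
  exists (a : nat -> C) (r : R), 0 < r /\
    forall w : C, Cmod (w - z)%C < r ->
      @is_pseries C_AbsRing C_NormedModule a (w - z)%C (f w).

Definition analytic_on_disk (f : C -> C) : Prop :=
  forall z : C, in_disk z -> analytic_at f z.

Definition univalent_on_disk (f : C -> C) : Prop :=
  forall z w : C, in_disk z -> in_disk w -> f z = f w -> z = w.

Definition disk_image (f : C -> C) (w : C) : Prop :=
  exists z : C, in_disk z /\ f z = w.

Definition starlike_wrt_0 (S : C -> Prop) : Prop :=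
  forall (w : C) (t : R), S w -> 0 <= t <= 1 -> S (RtoC t * w)%C.

(* [C_derive g z] is computed from difference quotients along the real
   direction; it is the complex derivative wherever g is complex differentiable
   ([C_derive_correct]), in particular at every point of the disk when g is
   analytic there. *)
Definition normalized_starlike (f : C -> C) : Prop :=
  analytic_on_disk f /\
  univalent_on_disk f /\
  f (RtoC 0) = RtoC 0 /\
  C_derive f (RtoC 0) = RtoC 1 /\
  starlike_wrt_0 (disk_image f).

(* Points of the Riemann sphere are elements of [option C], [None] being the
   point at infinity. *)
Definition pole (f : C -> C) (z : C) : option C :=
  let f1 := C_derive f in
  let f2 := C_derive f1 in
  if Ceq_dec (f2 z) (RtoC 0) then None
  else Some (z + RtoC 2 * f1 z / f2 z)%C.

Definition sphere_dist (p : option C) (c : C) : Rbar :=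
  match p with
  | Some w => Finite (Cmod (w - c)%C)
  | None => p_infty
  end.

Definition Cexp_i (theta : R) : C := (cos theta, sin theta).

Definition koebe_rotation (theta : R) (z : C) : C :=
  (z / ((RtoC 1 - Cexp_i theta * z) * (RtoC 1 - Cexp_i theta * z)))%C.

(* Main.v *)
Require Import Defs.
From Stdlib Require Import Reals.
From Coquelicot Require Import Coquelicot.
From Stdlib Require Import Lra Lia Psatz Classical ClassicalEpsilon.

(** Write [g z = f z / z] and [p z = z f' z / f z].  Then [f' = p g] and
    [f'' = g p' + p g'], with [g' / g = (p - 1) / z], so the bound
    [|f'' / f'| <= 2 (2 + |z|) / (1 - |z|^2)], which is the claim about the pole
    function, is a sum of two bounds for functions of positive real part:
    [|p'| (1 - |z|^2) <= 2 Re p] ([derivative_le_Re]) and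
    [|p - 1| <= 2 |z| / (1 - |z|)], the latter from Schwarz's lemma for
    [(p - 1) / (p + 1) = z s].  Equality forces [|s| = 1] at one point, hence
    [s] is a constant [c] ([schwarz_rigid]), and [g' (1 - c z) = 2 c g] gives
    [g = 1 / (1 - c z)^2], a Koebe function.  Conversely a Koebe rotation has
    equality at [z = 0].

    That [Re p >= 0] comes from the geometry.  For [0 < t < 1] the map
    [z -> f^{-1} (t f z)] is a holomorphic self-map of the disk fixing 0, so it
    decreases the modulus ([starlike_contraction]); the infinitesimal form of
    this at [t = 1] is [Re (z f' / f) >= 0] ([starlike_Re_nonneg]).  This
    requires that a univalent [f] have nonvanishing derivative and continuous
    inverse.  Both follow from the minimum principle [|F a| >= min |F|] over a
    circle, for [F] without zeros: it is applied to [f - f y]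
    ([inverse_continuous]) and to the difference quotients of [f]
    ([univalent_derive_neq0]).

    All the function theory rests on Cauchy's formula for continuously
    differentiable functions, proved by contracting the circle to a point and
    differentiating under the integral ([cauchy_homotopy_fst]).  Pairing with
    the conjugate kernel, which sees only the value at 0, turns it into
    Poisson's formula ([poisson_formula]).  For [F 0 = 0] the same device shows
    that [F z / z] is the Poisson mean of its boundary values
    ([quotient_formula]), whence Schwarz's lemma and its equality case without
    removing a singularity.  Power series serve to show that analytic
    functions, their derivatives and [f z / z] are continuously differentiable,
    that the zeros of [f'] are isolated, and that the difference quotients of
    [f] converge locally uniformly. *)

Open Scope R_scope.

(** * Continuity and differentiation of complex functions *)

Definition ccont (F : C -> C) (z : C) : Prop :=
  forall eps, 0 < eps -> exists d, 0 < d /\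
    forall w, Cmod (w - z)%C < d -> Cmod (F w - F z)%C < eps.

(** Differentiability in Caratheodory's form: the difference quotient extends
    continuously to [z].  Sums, products, inverses and compositions then become
    algebra on the quotients [q]. *)
Definition cderiv (F : C -> C) (z l : C) : Prop :=
  exists q : C -> C,
    (forall w, (F w - F z)%C = (q w * (w - z))%C) /\ q z = l /\ ccont q z.

Lemma Cmod_minus_sym z w : Cmod (z - w)%C = Cmod (w - z)%C.
Proof. rewrite <- Cmod_opp. f_equal. ring. Qed.

Lemma Cmod_minus_diag z : Cmod (z - z)%C = 0.
Proof. replace (z - z)%C with (RtoC 0) by ring. apply Cmod_0. Qed.

Lemma Cmod_rev_triangle z w : Cmod z - Cmod w <= Cmod (z - w)%C.
Proof.
  generalize (Cmod_triangle (z - w)%C w).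
  replace (z - w + w)%C with z by ring. lra.
Qed.

Lemma ccont_ext_loc F G z d :
  0 < d -> (forall w, Cmod (w - z)%C < d -> F w = G w) -> ccont F z -> ccont G z.
Proof.
  intros Hd E H eps He. destruct (H eps He) as [d' [Hd' H']].
  exists (Rmin d d'). split; [now apply Rmin_pos|]. intros w Hw.
  rewrite <- !E.
  - apply H'. eapply Rlt_le_trans; [exact Hw|apply Rmin_r].
  - rewrite Cmod_minus_diag. exact Hd.
  - eapply Rlt_le_trans; [exact Hw|apply Rmin_l].
Qed.

Lemma ccont_const c z : ccont (fun _ => c) z.
Proof. intros eps He. exists 1. split; [lra|]. intros. rewrite Cmod_minus_diag. lra. Qed.

Lemma ccont_id z : ccont (fun w => w) z.
Proof. intros eps He. exists eps. auto. Qed.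

Lemma ccont_plus F G z :
  ccont F z -> ccont G z -> ccont (fun w => F w + G w)%C z.
Proof.
  intros HF HG eps He.
  destruct (HF (eps / 2)) as [d1 [Hd1 H1]]; [lra|].
  destruct (HG (eps / 2)) as [d2 [Hd2 H2]]; [lra|].
  exists (Rmin d1 d2). split; [now apply Rmin_pos|]. intros w Hw.
  replace (F w + G w - (F z + G z))%C with ((F w - F z) + (G w - G z))%C by ring.
  eapply Rle_lt_trans; [apply Cmod_triangle|].
  generalize (H1 w (Rlt_le_trans _ _ _ Hw (Rmin_l _ _))).
  generalize (H2 w (Rlt_le_trans _ _ _ Hw (Rmin_r _ _))). lra.
Qed.

Lemma ccont_mult F G z :
  ccont F z -> ccont G z -> ccont (fun w => F w * G w)%C z.
Proof.
  intros HF HG eps He.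
  generalize (Cmod_ge_0 (F z)) (Cmod_ge_0 (G z)). intros Pf Pg.
  set (K := 1 + Cmod (F z) + Cmod (G z)).
  assert (HK : 0 < K) by (unfold K; lra).
  set (e := Rmin 1 (eps / K)).
  assert (He' : 0 < e).
  { apply Rmin_pos; [lra|]. now apply Rdiv_lt_0_compat. }
  destruct (HF e He') as [d1 [Hd1 H1]].
  destruct (HG e He') as [d2 [Hd2 H2]].
  exists (Rmin d1 d2). split; [now apply Rmin_pos|]. intros w Hw.
  specialize (H1 w (Rlt_le_trans _ _ _ Hw (Rmin_l _ _))).
  specialize (H2 w (Rlt_le_trans _ _ _ Hw (Rmin_r _ _))).
  replace (F w * G w - F z * G z)%C with
    ((F w - F z) * (G w - G z) + (F z * (G w - G z) + G z * (F w - F z)))%C by ring.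
  assert (e1 : e <= 1) by apply Rmin_l.
  assert (eK : e * K <= eps).
  { apply Rle_trans with (eps / K * K).
    - apply Rmult_le_compat_r; [lra|apply Rmin_r].
    - right. field. lra. }
  generalize (Cmod_ge_0 (F w - F z)%C) (Cmod_ge_0 (G w - G z)%C). intros P1 P2.
  apply Rle_lt_trans with (Cmod (F w - F z)%C * Cmod (G w - G z)%C
    + (Cmod (F z) * Cmod (G w - G z)%C + Cmod (G z) * Cmod (F w - F z)%C)).
  { rewrite <- !Cmod_mult.
    eapply Rle_trans; [apply Cmod_triangle|].
    apply Rplus_le_compat_l, Cmod_triangle. }
  apply Rlt_le_trans with (e * K); [|exact eK].
  unfold K. revert H1 H2 P1 P2 e1.
  generalize (Cmod (F w - F z)%C) (Cmod (G w - G z)%C). intros x y. nra.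
Qed.

Lemma ccont_inv F z :
  F z <> RtoC 0 -> ccont F z -> ccont (fun w => / F w)%C z.
Proof.
  intros Hz HF eps He.
  assert (Hm : 0 < Cmod (F z)) by now apply Cmod_gt_0.
  set (m := Cmod (F z)) in *.
  destruct (HF (Rmin (m / 2) (eps * m ^ 2 / 2))) as [d [Hd H]].
  { apply Rmin_pos; [lra|]. assert (0 < m ^ 2) by (apply pow_lt; lra). nra. }
  exists d. split; [exact Hd|]. intros w Hw. specialize (H w Hw).
  assert (H1 := Rlt_le_trans _ _ _ H (Rmin_l _ _)).
  assert (H2 := Rlt_le_trans _ _ _ H (Rmin_r _ _)).
  assert (Hw2 : m / 2 < Cmod (F w)).
  { generalize (Cmod_rev_triangle (F z) (F w)). rewrite Cmod_minus_sym.
    fold m. lra. }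
  assert (Hw0 : F w <> RtoC 0).
  { apply Cmod_gt_0. lra. }
  replace (/ F w - / F z)%C with ((F z - F w) / (F w * F z))%C by (field; auto).
  rewrite Cmod_div by now apply Cmult_neq_0.
  rewrite Cmod_mult, Cmod_minus_sym. fold m.
  apply Rlt_div_l; [nra|].
  apply Rlt_le_trans with (1 := H2).
  replace (eps * m ^ 2 / 2) with (eps * (m / 2 * m)) by field.
  apply Rmult_le_compat_l; [lra|]. apply Rmult_le_compat_r; lra.
Qed.

Lemma ccont_comp F G z :
  ccont F (G z) -> ccont G z -> ccont (fun w => F (G w)) z.
Proof.
  intros HF HG eps He. destruct (HF eps He) as [d [Hd H]].
  destruct (HG d Hd) as [d' [Hd' H']]. exists d'. split; auto.
Qed.

Lemma ccont_neq0 F z :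
  ccont F z -> F z <> RtoC 0 ->
  exists d, 0 < d /\ forall w, Cmod (w - z)%C < d -> F w <> RtoC 0.
Proof.
  intros CF Hz.
  destruct (CF (Cmod (F z))) as [d [Hd Hnz]]; [now apply Cmod_gt_0|].
  exists d. split; [exact Hd|]. intros w Hw E. specialize (Hnz w Hw).
  rewrite E, Cmod_minus_sym in Hnz.
  replace (F z - 0)%C with (F z) in Hnz by ring. lra.
Qed.

Lemma cderiv_ccont F z l : cderiv F z l -> ccont F z.
Proof.
  intros [q [E [_ Hq]]].
  apply ccont_ext_loc with (fun w => F z + q w * (w + - z))%C 1; [lra| |].
  - intros w _. generalize (E w). intros E'.
    replace (F w) with (F z + (F w - F z))%C by ring. rewrite E'. ring.
  - apply ccont_plus; [apply ccont_const|].
    apply ccont_mult; [exact Hq|].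
    apply ccont_plus; [apply ccont_id|apply ccont_const].
Qed.

Lemma cderiv_ext_loc F G z l d :
  0 < d -> (forall w, Cmod (w - z)%C < d -> F w = G w) ->
  cderiv F z l -> cderiv G z l.
Proof.
  intros Hd E [q [Eq [Hl Hq]]].
  exists (fun w => if Ceq_dec w z then l else ((G w - G z) / (w - z))%C).
  split; [|split].
  - intros w. destruct (Ceq_dec w z) as [->|Hw]; [ring|].
    field. intro H. apply Hw. apply Ceq_minus. exact H.
  - destruct (Ceq_dec z z); congruence.
  - apply ccont_ext_loc with q d; [exact Hd| |exact Hq].
    intros w Hw. destruct (Ceq_dec w z) as [->|Hwz]; [exact Hl|].
    rewrite <- !E; [| rewrite Cmod_minus_diag; exact Hd |exact Hw].
    rewrite Eq. field. intro H. apply Hwz. apply Ceq_minus. exact H.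
Qed.

Lemma cderiv_const c z : cderiv (fun _ => c) z (RtoC 0).
Proof.
  exists (fun _ => RtoC 0). split; [intros; ring|]. split; [reflexivity|].
  apply ccont_const.
Qed.

Lemma cderiv_id z : cderiv (fun w => w) z (RtoC 1).
Proof.
  exists (fun _ => RtoC 1). split; [intros; ring|]. split; [reflexivity|].
  apply ccont_const.
Qed.

Lemma cderiv_plus F G z l m :
  cderiv F z l -> cderiv G z m -> cderiv (fun w => F w + G w)%C z (l + m)%C.
Proof.
  intros [q [Eq [Hl Hq]]] [r [Er [Hm Hr]]].
  exists (fun w => q w + r w)%C. split; [|split].
  - intros w. replace (F w + G w - (F z + G z))%C
      with ((F w - F z) + (G w - G z))%C by ring.
    rewrite Eq, Er. ring.
  - now rewrite Hl, Hm.
  - now apply ccont_plus.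
Qed.

Lemma cderiv_mult F G z l m :
  cderiv F z l -> cderiv G z m ->
  cderiv (fun w => F w * G w)%C z (l * G z + F z * m)%C.
Proof.
  intros HF HG. assert (CG := cderiv_ccont _ _ _ HG).
  destruct HF as [q [Eq [Hl Hq]]]. destruct HG as [r [Er [Hm Hr]]].
  exists (fun w => q w * G w + F z * r w)%C. split; [|split].
  - intros w. replace (F w * G w - F z * G z)%C
      with ((F w - F z) * G w + F z * (G w - G z))%C by ring.
    rewrite Eq, Er. ring.
  - now rewrite Hl, Hm.
  - apply ccont_plus; apply ccont_mult; auto. apply ccont_const.
Qed.

Lemma cderiv_scal c z : cderiv (fun w => c * w)%C z c.
Proof.
  exists (fun _ => c). split; [intros; ring|]. split; [reflexivity|].
  apply ccont_const.
Qed.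

Lemma cderiv_inv F z l :
  cderiv F z l -> F z <> RtoC 0 ->
  cderiv (fun w => / F w)%C z (- l * (/ F z * / F z))%C.
Proof.
  intros HF Hz. assert (CF := cderiv_ccont _ _ _ HF).
  destruct (ccont_neq0 F z CF Hz) as [d [Hd Hnz]].
  destruct HF as [q [Eq [Hl Hq]]].
  exists (fun w => if Ceq_dec w z then (- l * (/ F z * / F z))%C
                   else ((/ F w - / F z) / (w - z))%C).
  split; [|split].
  - intros w. destruct (Ceq_dec w z) as [->|Hw]; [ring|].
    assert ((w - z)%C <> RtoC 0) by (intro H; apply Hw, Ceq_minus, H).
    unfold Cdiv. rewrite <- Cmult_assoc, Cinv_l by assumption. ring.
  - destruct (Ceq_dec z z); congruence.
  - apply ccont_ext_loc with (fun w => (- (1)) * q w * (/ F w * / F z))%C d; [exact Hd| |].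
    + intros w Hw. destruct (Ceq_dec w z) as [->|Hwz]; [rewrite Hl; ring|].
      assert ((w - z)%C <> RtoC 0) by (intro H; apply Hwz, Ceq_minus, H).
      assert (F w <> RtoC 0) by auto.
      replace (/ F w - / F z)%C with ((- (1)) * (F w - F z) * (/ F w * / F z))%C
        by (field; auto).
      rewrite Eq. field. auto.
    + apply ccont_mult; apply ccont_mult; auto using ccont_const, ccont_inv.
Qed.

Lemma cderiv_comp F G z l m :
  cderiv F (G z) l -> cderiv G z m -> cderiv (fun w => F (G w)) z (l * m)%C.
Proof.
  intros HF HG. assert (CG := cderiv_ccont _ _ _ HG).
  destruct HF as [q [Eq [Hl Hq]]]. destruct HG as [r [Er [Hm Hr]]].
  exists (fun w => q (G w) * r w)%C. split; [|split].
  - intros w. rewrite Eq, Er. ring.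
  - now rewrite Hl, Hm.
  - apply ccont_mult; [|exact Hr]. now apply ccont_comp.
Qed.

Lemma ccont_is_lim F z : ccont F z ->
  is_lim (fun x => fst (F (x, snd z))) (fst z) (fst (F z)) /\
  is_lim (fun x => snd (F (x, snd z))) (fst z) (snd (F z)).
Proof.
  intros H.
  split; apply is_lim_spec; intros [eps He];
  destruct (H eps He) as [d [Hd H']]; exists (mkposreal d Hd);
  intros x Hx _; simpl;
  (assert (B : Cmod ((x, snd z) - z)%C < d);
   [ replace ((x, snd z) - z)%C with (RtoC (x - fst z));
     [ rewrite Cmod_R; exact Hx
     | destruct z as [u v]; apply injective_projections; simpl; lra ]
   | specialize (H' _ B) ];
   generalize (Rmax_Cmod (F (x, snd z) - F z)%C); intros M).
  - exact (Rle_lt_trans _ _ _ (Rle_trans _ _ _ (Rmax_l _ _) M) H').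
  - exact (Rle_lt_trans _ _ _ (Rle_trans _ _ _ (Rmax_r _ _) M) H').
Qed.

Lemma cderiv_C_derive F z l : cderiv F z l -> C_derive F z = l.
Proof.
  intros [q [E [Hl Hq]]].
  destruct (ccont_is_lim q z Hq) as [H1 H2].
  assert (Q : forall x, x <> fst z ->
    (((F (x, snd z) - F z) / ((x, snd z) - z))%C = q (x, snd z))).
  { intros x Hx. rewrite E. field. intro K. apply Hx.
    destruct z as [u v]. unfold Cminus, Cplus, Copp, RtoC in K; simpl in *.
    injection K. intros. lra. }
  unfold C_derive, C_lim. rewrite <- Hl.
  rewrite (surjective_pairing (q z)). f_equal.
  - assert (L : is_lim (fun x => fst ((F (x, snd z) - F z) / ((x, snd z) - z))%C)
              (fst z) (fst (q z))).
    { apply is_lim_ext_loc with (2 := H1). exists (mkposreal 1 Rlt_0_1).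
      intros y _ Hy. rewrite Q; auto. }
    now rewrite (is_lim_unique _ _ _ L).
  - assert (L : is_lim (fun x => snd ((F (x, snd z) - F z) / ((x, snd z) - z))%C)
              (fst z) (snd (q z))).
    { apply is_lim_ext_loc with (2 := H2). exists (mkposreal 1 Rlt_0_1).
      intros y _ Hy. rewrite Q; auto. }
    now rewrite (is_lim_unique _ _ _ L).
Qed.

Lemma cderiv_unique F z l m : cderiv F z l -> cderiv F z m -> l = m.
Proof. intros H1 H2. rewrite <- (cderiv_C_derive _ _ _ H1). now apply cderiv_C_derive. Qed.

(** Continuous differentiability near the point is the regularity on which the
    function theory below is based: unlike expansions in power series, it passes
    to quotients and compositions at once. *)
Definition holo_at (F : C -> C) (z : C) : Prop :=
  exists (F' : C -> C) (d : R), 0 < d /\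
    forall w, Cmod (w - z)%C < d -> cderiv F w (F' w) /\ ccont F' w.

Lemma Cmod_sub_triangle w v z : Cmod (w - z)%C <= Cmod (w - v)%C + Cmod (v - z)%C.
Proof. replace (w - z)%C with ((w - v) + (v - z))%C by ring. apply Cmod_triangle. Qed.

Lemma holo_at_derive F z :
  holo_at F z -> cderiv F z (C_derive F z) /\ ccont (C_derive F) z.
Proof.
  intros [F' [d [Hd H]]].
  assert (E : forall w, Cmod (w - z)%C < d -> F' w = C_derive F w).
  { intros w Hw. symmetry. apply cderiv_C_derive. now apply H. }
  destruct (H z) as [H1 H2]; [rewrite Cmod_minus_diag; exact Hd|].
  split.
  - rewrite <- E; [exact H1|rewrite Cmod_minus_diag; exact Hd].
  - apply ccont_ext_loc with F' d; auto.
Qed.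

Lemma holo_at_ccont F z : holo_at F z -> ccont F z.
Proof. intros H. apply holo_at_derive in H. eapply cderiv_ccont, H. Qed.

Lemma holo_at_ext_loc F G z d :
  0 < d -> (forall w, Cmod (w - z)%C < d -> F w = G w) ->
  holo_at F z -> holo_at G z.
Proof.
  intros Hd E [F' [d' [Hd' H]]]. exists F', (Rmin d d').
  split; [now apply Rmin_pos|]. intros w Hw.
  assert (W1 := Rlt_le_trans _ _ _ Hw (Rmin_l _ _)).
  assert (W2 := Rlt_le_trans _ _ _ Hw (Rmin_r _ _)).
  destruct (H w W2) as [H1 H2]. split; [|exact H2].
  apply cderiv_ext_loc with F (d - Cmod (w - z)%C); [lra| |exact H1].
  intros v Hv. apply E. generalize (Cmod_sub_triangle v w z). lra.
Qed.

Lemma holo_at_const c z : holo_at (fun _ => c) z.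
Proof.
  exists (fun _ => RtoC 0), 1. split; [lra|]. intros.
  split; [apply cderiv_const|apply ccont_const].
Qed.

Lemma holo_at_id z : holo_at (fun w => w) z.
Proof.
  exists (fun _ => RtoC 1), 1. split; [lra|]. intros.
  split; [apply cderiv_id|apply ccont_const].
Qed.

Lemma holo_at_plus F G z :
  holo_at F z -> holo_at G z -> holo_at (fun w => F w + G w)%C z.
Proof.
  intros [F' [d [Hd HF]]] [G' [e [He HG]]].
  exists (fun w => F' w + G' w)%C, (Rmin d e). split; [now apply Rmin_pos|].
  intros w Hw.
  destruct (HF w (Rlt_le_trans _ _ _ Hw (Rmin_l _ _))).
  destruct (HG w (Rlt_le_trans _ _ _ Hw (Rmin_r _ _))).
  split; [now apply cderiv_plus|now apply ccont_plus].
Qed.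

Lemma holo_at_mult F G z :
  holo_at F z -> holo_at G z -> holo_at (fun w => F w * G w)%C z.
Proof.
  intros [F' [d [Hd HF]]] [G' [e [He HG]]].
  exists (fun w => F' w * G w + F w * G' w)%C, (Rmin d e).
  split; [now apply Rmin_pos|]. intros w Hw.
  destruct (HF w (Rlt_le_trans _ _ _ Hw (Rmin_l _ _))) as [A B].
  destruct (HG w (Rlt_le_trans _ _ _ Hw (Rmin_r _ _))) as [A' B'].
  split; [now apply cderiv_mult|].
  apply ccont_plus; apply ccont_mult; eauto using cderiv_ccont.
Qed.

Lemma holo_at_opp F z : holo_at F z -> holo_at (fun w => - F w)%C z.
Proof.
  intros H. apply holo_at_ext_loc with (fun w => - (1) * F w)%C 1; [lra| |].
  - intros. ring.
  - apply holo_at_mult; [apply holo_at_const|exact H].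
Qed.

Lemma holo_at_minus F G z :
  holo_at F z -> holo_at G z -> holo_at (fun w => F w - G w)%C z.
Proof. intros HF HG. apply holo_at_plus; [exact HF|now apply holo_at_opp]. Qed.

Lemma holo_at_inv F z :
  holo_at F z -> F z <> RtoC 0 -> holo_at (fun w => / F w)%C z.
Proof.
  intros H Hz. destruct (ccont_neq0 F z (holo_at_ccont _ _ H) Hz) as [e [He HN]].
  destruct H as [F' [d [Hd HF]]].
  exists (fun w => - F' w * (/ F w * / F w))%C, (Rmin d e).
  split; [now apply Rmin_pos|]. intros w Hw.
  destruct (HF w (Rlt_le_trans _ _ _ Hw (Rmin_l _ _))) as [A B].
  assert (N := HN w (Rlt_le_trans _ _ _ Hw (Rmin_r _ _))).
  split; [now apply cderiv_inv|].
  assert (ccont (fun v => / F v)%C w) by (apply ccont_inv; eauto using cderiv_ccont).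
  apply ccont_mult; [|now apply ccont_mult].
  apply ccont_ext_loc with (fun v => - (1) * F' v)%C 1; [lra|intros; ring|].
  apply ccont_mult; auto using ccont_const.
Qed.

Lemma holo_at_div F G z :
  holo_at F z -> holo_at G z -> G z <> RtoC 0 -> holo_at (fun w => F w / G w)%C z.
Proof. intros. apply holo_at_mult; [assumption|now apply holo_at_inv]. Qed.

Lemma holo_at_comp F G z :
  holo_at F (G z) -> holo_at G z -> holo_at (fun w => F (G w)) z.
Proof.
  intros [F' [d [Hd HF]]] HG.
  destruct (holo_at_ccont _ _ HG d Hd) as [d2 [Hd2 H2]].
  destruct HG as [G' [e [He HG]]].
  exists (fun w => F' (G w) * G' w)%C, (Rmin d2 e).
  split; [now apply Rmin_pos|]. intros w Hw.
  destruct (HF (G w)) as [A B].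
  { apply H2. eapply Rlt_le_trans; [exact Hw|apply Rmin_l]. }
  destruct (HG w (Rlt_le_trans _ _ _ Hw (Rmin_r _ _))) as [A' B'].
  split; [now apply cderiv_comp|].
  apply ccont_mult; [|exact B']. apply ccont_comp; eauto using cderiv_ccont.
Qed.

(** * Means over the unit circle *)

(** Continuity of a complex function of real variables.  It is stated by
    components because the real integrals below are taken componentwise. *)
Definition tcont {T : UniformSpace} (h : T -> C) (x : T) : Prop :=
  continuous (fun y => fst (h y)) x /\ continuous (fun y => snd (h y)) x.

Lemma tcont_const {T : UniformSpace} (c : C) (x : T) : tcont (fun _ => c) x.
Proof. split; apply continuous_const. Qed.

Lemma tcont_plus {T : UniformSpace} (h k : T -> C) x :
  tcont h x -> tcont k x -> tcont (fun y => h y + k y)%C x.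
Proof.
  intros [H1 H2] [K1 K2]. split.
  - exact (continuous_plus (fun y => fst (h y)) (fun y => fst (k y)) x H1 K1).
  - exact (continuous_plus (fun y => snd (h y)) (fun y => snd (k y)) x H2 K2).
Qed.

Lemma tcont_mult {T : UniformSpace} (h k : T -> C) x :
  tcont h x -> tcont k x -> tcont (fun y => h y * k y)%C x.
Proof.
  intros [H1 H2] [K1 K2]. split.
  - exact (continuous_minus (fun y => fst (h y) * fst (k y))
             (fun y => snd (h y) * snd (k y)) x
      (continuous_mult (fun y => fst (h y)) (fun y => fst (k y)) x H1 K1)
      (continuous_mult (fun y => snd (h y)) (fun y => snd (k y)) x H2 K2)).
  - exact (continuous_plus (fun y => fst (h y) * snd (k y))
             (fun y => snd (h y) * fst (k y)) x
      (continuous_mult (fun y => fst (h y)) (fun y => snd (k y)) x H1 K2)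
      (continuous_mult (fun y => snd (h y)) (fun y => fst (k y)) x H2 K1)).
Qed.

Lemma tcont_conj {T : UniformSpace} (h : T -> C) x :
  tcont h x -> tcont (fun y => Cconj (h y)) x.
Proof.
  intros [H1 H2]. split; [exact H1|].
  exact (continuous_opp (fun y => snd (h y)) x H2).
Qed.

Lemma tcont_RtoC {T : UniformSpace} (h : T -> R) x :
  continuous h x -> tcont (fun y => RtoC (h y)) x.
Proof. intros H. split; [exact H|apply continuous_const]. Qed.

Lemma tcont_spec {T : UniformSpace} (h : T -> C) x :
  tcont h x <->
  forall eps, 0 < eps -> locally x (fun y => Cmod (h y - h x)%C < eps).
Proof.
  split.
  - intros [H1 H2] eps He.
    assert (He2 : 0 < eps / 2) by lra.
    generalize (proj1 (filterlim_locally _ _) H1 (mkposreal _ He2)).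
    generalize (proj1 (filterlim_locally _ _) H2 (mkposreal _ He2)).
    intros L2 L1. generalize (filter_and _ _ L1 L2).
    apply filter_imp. intros y [B1 B2].
    change (Rabs (fst (h y) - fst (h x)) < eps / 2) in B1.
    change (Rabs (snd (h y) - snd (h x)) < eps / 2) in B2.
    replace (h y - h x)%C with (RtoC (fst (h y) - fst (h x))
       + Ci * RtoC (snd (h y) - snd (h x)))%C
      by (apply injective_projections; simpl; ring).
    eapply Rle_lt_trans; [apply Cmod_triangle|].
    rewrite Cmod_mult, Cmod_Ci, !Cmod_R. lra.
  - intros H. split; apply filterlim_locally; intros [eps He];
    generalize (H eps He); apply filter_imp; intros y Hy;
    generalize (Rmax_Cmod (h y - h x)%C); intros M.
    + exact (Rle_lt_trans _ _ _ (Rle_trans _ _ _ (Rmax_l _ _) M) Hy).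
    + exact (Rle_lt_trans _ _ _ (Rle_trans _ _ _ (Rmax_r _ _) M) Hy).
Qed.

Lemma tcont_comp {T : UniformSpace} (F : C -> C) (h : T -> C) x :
  ccont F (h x) -> tcont h x -> tcont (fun y => F (h y)) x.
Proof.
  intros HF Hh. apply tcont_spec. intros eps He.
  destruct (HF eps He) as [d [Hd H]].
  generalize (proj1 (tcont_spec h x) Hh d Hd). apply filter_imp. intros y. apply H.
Qed.

Lemma tcont_Cmod {T : UniformSpace} (h : T -> C) x :
  tcont h x -> continuous (fun y => Cmod (h y)) x.
Proof.
  intros H. apply filterlim_locally. intros [eps He].
  generalize (proj1 (tcont_spec h x) H eps He). apply filter_imp.
  intros y Hy. change (Rabs (Cmod (h y) - Cmod (h x)) < eps).
  apply Rabs_def1.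
  - generalize (Cmod_rev_triangle (h y) (h x)). lra.
  - generalize (Cmod_rev_triangle (h x) (h y)). rewrite Cmod_minus_sym. lra.
Qed.

Lemma two_PI_pos : 0 < 2 * PI.
Proof. generalize PI_RGT_0. lra. Qed.

Definition rmean (k : R -> R) : R := RInt k 0 (2 * PI) / (2 * PI).

Definition cmean (h : R -> C) : C :=
  (rmean (fun t => fst (h t)), rmean (fun t => snd (h t))).

Lemma ex_RInt_cont (k : R -> R) a b : (forall t, continuous k t) -> ex_RInt k a b.
Proof. intros H. apply (ex_RInt_continuous (V := R_CompleteNormedModule)). auto. Qed.

Lemma rmean_ext k m :
  (forall t, 0 <= t <= 2 * PI -> k t = m t) -> rmean k = rmean m.
Proof.
  intros H. unfold rmean. f_equal. apply RInt_ext.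
  rewrite Rmin_left, Rmax_right by (generalize two_PI_pos; lra).
  intros x Hx. apply H. lra.
Qed.

Lemma rmean_const c : rmean (fun _ => c) = c.
Proof.
  unfold rmean. rewrite RInt_const. change (scal (2 * PI - 0) c) with ((2 * PI - 0) * c).
  field. generalize PI_RGT_0. lra.
Qed.

Lemma rmean_plus k m : (forall t, continuous k t) -> (forall t, continuous m t) ->
  rmean (fun t => k t + m t) = rmean k + rmean m.
Proof.
  intros Hk Hm. unfold rmean.
  assert (S : RInt (fun t => k t + m t) 0 (2 * PI)
              = RInt k 0 (2 * PI) + RInt m 0 (2 * PI)).
  { apply (RInt_plus (V := R_CompleteNormedModule) k m); now apply ex_RInt_cont. }
  rewrite S.
  field. generalize PI_RGT_0. lra.
Qed.

Lemma rmean_scal c k : (forall t, continuous k t) ->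
  rmean (fun t => c * k t) = c * rmean k.
Proof.
  intros Hk. unfold rmean.
  assert (S : RInt (fun t => c * k t) 0 (2 * PI) = c * RInt k 0 (2 * PI)).
  { apply (RInt_scal (V := R_CompleteNormedModule) k). now apply ex_RInt_cont. }
  rewrite S.
  field. generalize PI_RGT_0. lra.
Qed.

Lemma rmean_le k m : (forall t, continuous k t) -> (forall t, continuous m t) ->
  (forall t, 0 <= t <= 2 * PI -> k t <= m t) -> rmean k <= rmean m.
Proof.
  intros Hk Hm H. unfold rmean. apply Rmult_le_compat_r.
  - left. apply Rinv_0_lt_compat, two_PI_pos.
  - apply RInt_le; [generalize two_PI_pos; lra| | |].
    + now apply ex_RInt_cont.
    + now apply ex_RInt_cont.
    + intros. apply H. lra.
Qed.

Lemma rmean_nonneg_eq0 k :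
  (forall t, continuous k t) -> (forall t, 0 <= t <= 2 * PI -> 0 <= k t) ->
  rmean k = 0 -> forall t, 0 < t < 2 * PI -> k t = 0.
Proof.
  intros Hk Hp H0 t Ht.
  assert (I0 : RInt k 0 (2 * PI) = 0).
  { unfold rmean in H0. generalize two_PI_pos. intros.
    apply (Rmult_eq_reg_r (/ (2 * PI))).
    - unfold Rdiv in H0. rewrite H0. ring.
    - apply Rinv_neq_0_compat. lra. }
  (* The primitive vanishes identically, hence so does its derivative. *)
  assert (Z : forall x, 0 <= x <= 2 * PI -> RInt k 0 x = 0).
  { intros x Hx.
    assert (A : 0 <= RInt k 0 x).
    { apply RInt_ge_0; [lra|now apply ex_RInt_cont|]. intros; apply Hp; lra. }
    assert (B : 0 <= RInt k x (2 * PI)).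
    { apply RInt_ge_0; [lra|now apply ex_RInt_cont|]. intros; apply Hp; lra. }
    assert (S : RInt k 0 x + RInt k x (2 * PI) = RInt k 0 (2 * PI)).
    { apply (RInt_Chasles k); now apply ex_RInt_cont. }
    lra. }
  assert (D : is_derive (fun x => RInt k 0 x) t (k t)).
  { apply (is_derive_RInt k _ 0); [|apply Hk]. exists (mkposreal 1 Rlt_0_1).
    intros y _. apply (RInt_correct k). now apply ex_RInt_cont. }
  assert (D0 : is_derive (fun x : R => 0) t (k t)).
  { apply is_derive_ext_loc with (2 := D).
    assert (P : 0 < Rmin t (2 * PI - t)) by (apply Rmin_pos; lra).
    exists (mkposreal _ P). intros y Hy.
    change (Rabs (y - t) < Rmin t (2 * PI - t)) in Hy.
    assert (Y1 := Rlt_le_trans _ _ _ Hy (Rmin_l _ _)).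
    assert (Y2 := Rlt_le_trans _ _ _ Hy (Rmin_r _ _)).
    apply Rabs_def2 in Y1. apply Rabs_def2 in Y2. apply Z. lra. }
  rewrite <- (is_derive_unique _ _ _ D0). apply Derive_const.
Qed.

Lemma cmean_ext h k :
  (forall t, 0 <= t <= 2 * PI -> h t = k t) -> cmean h = cmean k.
Proof.
  intros H. unfold cmean. f_equal; apply rmean_ext; intros t Ht; now rewrite H.
Qed.

Lemma cmean_const c : cmean (fun _ => c) = c.
Proof. unfold cmean. rewrite !rmean_const. now destruct c. Qed.

Lemma cmean_plus h k : (forall t, tcont h t) -> (forall t, tcont k t) ->
  cmean (fun t => h t + k t)%C = (cmean h + cmean k)%C.
Proof.
  intros Hh Hk. unfold cmean, Cplus. simpl.
  f_equal; apply rmean_plus; intros t.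
  - exact (proj1 (Hh t)).
  - exact (proj1 (Hk t)).
  - exact (proj2 (Hh t)).
  - exact (proj2 (Hk t)).
Qed.

Lemma cmean_scal c h : (forall t, tcont h t) ->
  cmean (fun t => c * h t)%C = (c * cmean h)%C.
Proof.
  intros Hh. destruct c as [u v]. unfold cmean, Cmult. simpl.
  assert (H1 : forall t, continuous (fun t => fst (h t)) t) by apply Hh.
  assert (H2 : forall t, continuous (fun t => snd (h t)) t) by apply Hh.
  assert (S : forall c (k : R -> R), (forall t, continuous k t) ->
            forall t, continuous (fun t => c * k t) t).
  { intros c k Hk t. apply (continuous_mult (fun _ => c) k);
    [apply continuous_const|apply Hk]. }
  f_equal.
  - rewrite (rmean_ext _ (fun t => u * fst (h t) + (- v) * snd (h t)))
      by (intros; ring).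
    rewrite rmean_plus, !rmean_scal; auto. ring.
  - rewrite rmean_plus, !rmean_scal; auto.
Qed.

Lemma cmean_conj h : (forall t, tcont h t) ->
  cmean (fun t => Cconj (h t)) = Cconj (cmean h).
Proof.
  intros Hh. unfold cmean, Cconj. simpl. f_equal.
  rewrite (rmean_ext _ (fun t => (- 1) * snd (h t))) by (intros; ring).
  rewrite rmean_scal; [ring|apply Hh].
Qed.

Lemma cmean_RtoC k : cmean (fun t => RtoC (k t)) = RtoC (rmean k).
Proof. unfold cmean, RtoC. simpl. now rewrite rmean_const. Qed.

(** Rotating the mean onto the positive axis reduces the triangle inequality
    for integrals to monotonicity of a real integral. *)
Lemma cmean_norm h k : (forall t, tcont h t) -> (forall t, continuous k t) ->
  (forall t, 0 <= t <= 2 * PI -> Cmod (h t) <= k t) -> Cmod (cmean h) <= rmean k.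
Proof.
  intros Hh Hk H. set (c := cmean h).
  destruct (Ceq_dec c (RtoC 0)) as [Z|NZ].
  - rewrite Z, Cmod_0, <- (rmean_const 0). apply rmean_le; auto using continuous_const.
    intros t Ht. generalize (Cmod_ge_0 (h t)) (H t Ht). lra.
  - assert (P : 0 < Cmod c) by now apply Cmod_gt_0.
    set (u := (Cconj c / RtoC (Cmod c))%C).
    assert (P' : RtoC (Cmod c) <> RtoC 0) by (intro K; apply RtoC_inj in K; lra).
    assert (U : Cmod u = 1).
    { unfold u. rewrite Cmod_div, Cmod_conj, Cmod_R, Rabs_pos_eq by (auto; lra).
      field. lra. }
    assert (UC : (u * c)%C = RtoC (Cmod c)).
    { unfold u. transitivity (c * Cconj c / RtoC (Cmod c))%C; [field; exact P'|].
      rewrite <- Cmod2_conj, <- RtoC_div by lra. f_equal. field. lra. }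
    replace (Cmod c) with (fst (cmean (fun t => u * h t)%C)).
    + unfold cmean. simpl fst. apply rmean_le; [|exact Hk|].
      * intros t. exact (proj1 (tcont_mult (fun _ => u) h t (tcont_const u t) (Hh t))).
      * intros t Ht. apply Rle_trans with (2 := H t Ht).
        replace (Cmod (h t)) with (Cmod (u * h t)%C) by (rewrite Cmod_mult, U; ring).
        apply Rle_trans with (2 := re_le_Cmod _). apply Rle_abs.
    + rewrite cmean_scal by exact Hh. fold c. now rewrite UC.
Qed.

(** * Differentiation along curves *)

(** Caratheodory's form again, so that the chain rule with [cderiv] is a product
    of difference quotients. *)
Definition pderiv (g : R -> C) (s : R) (l : C) : Prop :=
  exists q : R -> C,
    (forall x, (g x - g s)%C = (q x * RtoC (x - s))%C) /\ q s = l /\ tcont q s.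

Lemma pderiv_tcont g s l : pderiv g s l -> tcont g s.
Proof.
  intros [q [E [_ Hq]]].
  assert (H : tcont (fun x => g s + q x * RtoC (x - s))%C s).
  { apply tcont_plus; [apply tcont_const|]. apply tcont_mult; [exact Hq|].
    apply tcont_RtoC. apply (continuous_minus (fun x : R => x) (fun _ => s));
    [apply continuous_id|apply continuous_const]. }
  assert (X : forall x, (g s + q x * RtoC (x - s))%C = g x).
  { intros x. rewrite <- E. ring. }
  destruct H as [H1 H2].
  split; [eapply continuous_ext; [|exact H1]|eapply continuous_ext; [|exact H2]];
  intros x; simpl; now rewrite <- (X x).
Qed.

Lemma pderiv_comp F g s l m :
  cderiv F (g s) l -> pderiv g s m -> pderiv (fun x => F (g x)) s (l * m)%C.
Proof.
  intros [q [E [Hl Hq]]] Hg. assert (Cg := pderiv_tcont _ _ _ Hg).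
  destruct Hg as [r [E' [Hm Hr]]].
  exists (fun x => q (g x) * r x)%C. split; [|split].
  - intros x. rewrite E, E'. ring.
  - now rewrite Hl, Hm.
  - apply tcont_mult; [now apply tcont_comp|exact Hr].
Qed.

Lemma pderiv_fst g s l : pderiv g s l -> is_derive (fun x => fst (g x)) s (fst l).
Proof.
  intros [q [E [Hl [Hq _]]]]. apply is_derive_Reals.
  intros eps He.
  destruct (proj1 (filterlim_locally _ _) Hq (mkposreal eps He)) as [d Hd].
  exists d. intros h Hh Hd'.
  specialize (Hd (s + h)). rewrite <- Hl.
  assert (B : ball s d (s + h)).
  { change (Rabs (s + h - s) < d). rewrite Rplus_minus_l. exact Hd'. }
  specialize (Hd B). change (Rabs (fst (q (s + h)) - fst (q s)) < eps) in Hd.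
  assert (E1 := f_equal fst (E (s + h))). simpl in E1.
  replace (fst (g (s + h)) - fst (g s)) with (fst (q (s + h)) * h).
  - now replace (fst (q (s + h)) * h / h) with (fst (q (s + h))) by (field; exact Hh).
  - unfold Rminus. rewrite E1. ring.
Qed.

Lemma pderiv_line a b s : pderiv (fun x => a + RtoC x * b)%C s b.
Proof.
  exists (fun _ => b). split; [|split; [reflexivity|apply tcont_const]].
  intros x. rewrite RtoC_minus. ring.
Qed.

Lemma slope_continuous (f : R -> R) s l :
  is_derive f s l ->
  exists q : R -> R, (forall x, f x - f s = q x * (x - s)) /\ q s = l /\ continuous q s.
Proof.
  intros H. apply is_derive_Reals in H.
  exists (fun x => if Req_EM_T x s then l else (f x - f s) / (x - s)).
  split; [|split].
  - intros x. destruct (Req_EM_T x s) as [->|N]; [ring|field; lra].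
  - destruct (Req_EM_T s s); congruence.
  - apply filterlim_locally. intros [eps He]. destruct (H eps He) as [d Hd].
    exists d. intros y Hy. change (Rabs (y - s) < d) in Hy.
    change (Rabs ((if Req_EM_T y s then l else (f y - f s) / (y - s))
              - (if Req_EM_T s s then l else (f s - f s) / (s - s))) < eps).
    destruct (Req_EM_T s s) as [_|N]; [|congruence].
    destruct (Req_EM_T y s) as [->|N].
    + now replace (l - l) with 0 by ring; rewrite Rabs_R0.
    + specialize (Hd (y - s)). rewrite Rplus_minus in Hd.
      apply Hd; [lra|exact Hy].
Qed.

Lemma pderiv_Cexp_i t : pderiv Cexp_i t (Ci * Cexp_i t)%C.
Proof.
  destruct (slope_continuous cos t (- sin t)) as [q [E [Hq Cq]]].
  { apply is_derive_Reals, derivable_pt_lim_cos. }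
  destruct (slope_continuous sin t (cos t)) as [r [E' [Hr Cr]]].
  { apply is_derive_Reals, derivable_pt_lim_sin. }
  exists (fun x => (q x, r x)). split; [|split].
  - intros x. unfold Cexp_i. apply injective_projections; simpl.
    + generalize (E x). lra.
    + generalize (E' x). lra.
  - unfold Cexp_i. apply injective_projections; simpl; lra.
  - split; assumption.
Qed.

Lemma tcont_Cexp_i t : tcont Cexp_i t.
Proof. eapply pderiv_tcont, pderiv_Cexp_i. Qed.

Lemma Cmod_Cexp_i t : Cmod (Cexp_i t) = 1.
Proof.
  unfold Cmod, Cexp_i. simpl fst; simpl snd.
  generalize (sin2_cos2 t). unfold Rsqr. intros H.
  replace (cos t ^ 2 + sin t ^ 2) with 1 by (simpl; lra). apply sqrt_1.
Qed.

Lemma Cexp_i_conj t : (Cexp_i t * Cconj (Cexp_i t))%C = RtoC 1.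
Proof. rewrite <- Cmod2_conj, Cmod_Cexp_i. f_equal. ring. Qed.

(** * Cauchy's and Poisson's formulas on the unit disk *)

(** Cauchy's kernel: [dz / (z - a)] at [z = Cexp_i t], divided by [i dt]. *)
Definition ck (a : C) (t : R) : C := (/ (RtoC 1 - a * Cconj (Cexp_i t)))%C.

Lemma ck_den_neq0 a t : Cmod a < 1 -> (RtoC 1 - a * Cconj (Cexp_i t))%C <> RtoC 0.
Proof.
  intros Ha H. apply (f_equal Cmod) in H. rewrite Cmod_0 in H.
  generalize (Cmod_rev_triangle (RtoC 1) (a * Cconj (Cexp_i t))%C).
  rewrite Cmod_mult, Cmod_conj, Cmod_Cexp_i, Cmod_1. lra.
Qed.

Lemma ck_bound a t : Cmod a < 1 -> Cmod (ck a t) <= / (1 - Cmod a).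
Proof.
  intros Ha. unfold ck. rewrite Cmod_inv by now apply ck_den_neq0.
  apply Rinv_le_contravar; [lra|].
  generalize (Cmod_rev_triangle (RtoC 1) (a * Cconj (Cexp_i t))%C).
  rewrite Cmod_mult, Cmod_conj, Cmod_Cexp_i, Cmod_1. lra.
Qed.

Lemma tcont_ck a t : Cmod a < 1 -> tcont (ck a) t.
Proof.
  intros Ha. unfold ck.
  apply (tcont_comp (fun z => / (RtoC 1 - a * z))%C (fun t => Cconj (Cexp_i t))).
  - apply (ccont_inv (fun z => RtoC 1 - a * z)%C); [now apply ck_den_neq0|].
    apply holo_at_ccont, holo_at_minus; [apply holo_at_const|].
    apply holo_at_mult; [apply holo_at_const|apply holo_at_id].
  - apply tcont_conj, tcont_Cexp_i.
Qed.

(** For [s] from 1 to 0 these curves contract the unit circle to [a]. *)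
Definition segm (a : C) (s t : R) : C := (a + RtoC s * (Cexp_i t - a))%C.

Lemma segm_bound a s t : Cmod a < 1 -> Cmod (segm a s t) <= Rabs (1 - s) + Rabs s.
Proof.
  intros Ha. unfold segm.
  replace (a + RtoC s * (Cexp_i t - a))%C
    with (RtoC (1 - s) * a + RtoC s * Cexp_i t)%C by (rewrite RtoC_minus; ring).
  eapply Rle_trans; [apply Cmod_triangle|].
  rewrite !Cmod_mult, !Cmod_R, Cmod_Cexp_i.
  generalize (Rabs_pos (1 - s)) (Cmod_ge_0 a). nra.
Qed.

Lemma segm_in rad s a t : 1 < rad -> Cmod a < 1 ->
  - ((rad - 1) / 3) < s < 1 + (rad - 1) / 3 -> Cmod (segm a s t) < rad.
Proof.
  intros Hrad Ha Hs. eapply Rle_lt_trans; [now apply segm_bound|].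
  unfold Rabs. destruct (Rcase_abs (1 - s)), (Rcase_abs s); lra.
Qed.

Lemma segm_derive_l F a s t rad :
  1 < rad -> (forall z, Cmod z < rad -> holo_at F z) -> Cmod a < 1 ->
  Cmod (segm a s t) < rad ->
  is_derive (fun u => fst (F (segm a u t) * ck a t)%C) s
    (fst (C_derive F (segm a s t) * Cexp_i t)%C).
Proof.
  intros Hrad HF Ha Hs.
  assert (D : pderiv (fun u => F (segm a u t) * ck a t)%C s
     ((C_derive F (segm a s t) * ck a t + F (segm a s t) * RtoC 0)
       * (Cexp_i t - a))%C).
  { apply (pderiv_comp (fun w => F w * ck a t)%C (fun u => segm a u t)).
    - apply cderiv_mult; [apply holo_at_derive; auto|apply cderiv_const].
    - apply pderiv_line. }
  apply pderiv_fst in D.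
  replace (C_derive F (segm a s t) * Cexp_i t)%C with
    ((C_derive F (segm a s t) * ck a t + F (segm a s t) * RtoC 0)
       * (Cexp_i t - a))%C; [exact D|].
  assert (E : (Cexp_i t - a = Cexp_i t * (RtoC 1 - a * Cconj (Cexp_i t)))%C).
  { transitivity (Cexp_i t - a * (Cexp_i t * Cconj (Cexp_i t)))%C; [|ring].
    rewrite Cexp_i_conj. ring. }
  rewrite E. unfold ck. field. now apply ck_den_neq0.
Qed.

Lemma Cexp_i_2PI : Cexp_i (2 * PI) = Cexp_i 0.
Proof. unfold Cexp_i. now rewrite cos_2PI, sin_2PI, cos_0, sin_0. Qed.

Lemma RInt_periodic_derive (A : R -> C) (d : R -> C) :
  (forall t, pderiv A t (d t)) -> (forall t, tcont d t) ->
  A (2 * PI) = A 0 -> RInt (fun t => fst (d t)) 0 (2 * PI) = 0.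
Proof.
  intros HA Hd HP. apply is_RInt_unique.
  replace 0 with (minus (fst (A (2 * PI))) (fst (A 0))) at 2
    by (rewrite HP; apply (minus_eq_zero (fst (A 0)))).
  apply (is_RInt_derive (fun t => fst (A t))).
  - intros t _. now apply pderiv_fst.
  - intros t _. exact (proj1 (Hd t)).
Qed.

Lemma segm_tcont_t a s t : tcont (fun t => segm a s t) t.
Proof.
  unfold segm. apply tcont_plus; [apply tcont_const|].
  apply tcont_mult; [apply tcont_const|].
  apply tcont_plus; [apply tcont_Cexp_i|apply tcont_const].
Qed.

(** The integrand is, up to a constant, the derivative in [t] of a function of
    period [2 PI]. *)
Lemma homotopy_derivative_zero F a s rad :
  1 < rad -> (forall z, Cmod z < rad -> holo_at F z) -> Cmod a < 1 ->
  (forall t, Cmod (segm a s t) < rad) ->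
  RInt (fun t => fst (C_derive F (segm a s t) * Cexp_i t)%C) 0 (2 * PI) = 0.
Proof.
  intros Hrad HF Ha Hs.
  assert (Cd : forall t, tcont (fun t => C_derive F (segm a s t) * Cexp_i t)%C t).
  { intros t. apply tcont_mult; [|apply tcont_Cexp_i].
    apply (tcont_comp (C_derive F)); [apply holo_at_derive; auto|apply segm_tcont_t]. }
  destruct (Req_dec s 0) as [->|Ns].
  - apply (RInt_periodic_derive
      (fun t => - Ci * C_derive F (segm a 0 0) * Cexp_i t)%C); [| exact Cd |].
    + intros t.
      replace (C_derive F (segm a 0 t) * Cexp_i t)%C with
        ((RtoC 0 * Cexp_i t + - Ci * C_derive F (segm a 0 0) * RtoC 1)
         * (Ci * Cexp_i t))%C.
      * apply (pderiv_comp (fun z => - Ci * C_derive F (segm a 0 0) * z)%C Cexp_i).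
        -- apply (cderiv_mult (fun _ => - Ci * C_derive F (segm a 0 0))%C (fun z => z));
           [apply cderiv_const|apply cderiv_id].
        -- apply pderiv_Cexp_i.
      * assert (I : (Ci * Ci = - (1))%C)
          by (apply injective_projections; simpl; ring).
        assert (S : segm a 0 t = segm a 0 0) by (unfold segm; ring).
        rewrite S. transitivity (- (Ci * Ci) * C_derive F (segm a 0 0) * Cexp_i t)%C;
        [ring|rewrite I; ring].
    + now rewrite Cexp_i_2PI.
  - assert (Ns' : RtoC s <> RtoC 0) by (intro K; apply RtoC_inj in K; auto).
    apply (RInt_periodic_derive (fun t => - Ci / RtoC s * F (segm a s t))%C);
    [| exact Cd |].
    + intros t.
      replace (C_derive F (segm a s t) * Cexp_i t)%C with
        ((RtoC 0 * F (segm a s t) + - Ci / RtoC s * C_derive F (segm a s t))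
         * (RtoC s * (Ci * Cexp_i t)))%C.
      * apply (pderiv_comp (fun z => - Ci / RtoC s * F z)%C (fun t => segm a s t)).
        -- apply (cderiv_mult (fun _ => - Ci / RtoC s)%C F);
           [apply cderiv_const|apply holo_at_derive; auto].
        -- unfold segm.
           replace (RtoC s * (Ci * Cexp_i t))%C with
             ((RtoC 0 + (RtoC 0 * (Cexp_i t - a) + RtoC s * (RtoC 1 + RtoC 0)))
               * (Ci * Cexp_i t))%C by ring.
           apply (pderiv_comp (fun z => a + RtoC s * (z - a))%C Cexp_i);
           [|apply pderiv_Cexp_i].
           apply cderiv_plus; [apply cderiv_const|].
           apply (cderiv_mult (fun _ => RtoC s) (fun z => z - a)%C);
           [apply cderiv_const|].
           apply cderiv_plus; [apply cderiv_id|apply cderiv_const].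
      * assert (I : (Ci * Ci = - (1))%C)
          by (apply injective_projections; simpl; ring).
        transitivity (- (Ci * Ci) * C_derive F (segm a s t) * Cexp_i t)%C;
        [field; exact Ns'|rewrite I; ring].
    + unfold segm. now rewrite Cexp_i_2PI.
Qed.

Lemma tcont_snd_Cexp_i (p : R * R) : tcont (fun p : R * R => Cexp_i (snd p)) p.
Proof.
  destruct (tcont_Cexp_i (snd p)) as [H1 H2].
  split.
  - apply (continuous_comp (fun p : R * R => snd p) (fun t => fst (Cexp_i t)));
    [apply continuous_snd|exact H1].
  - apply (continuous_comp (fun p : R * R => snd p) (fun t => snd (Cexp_i t)));
    [apply continuous_snd|exact H2].
Qed.

Lemma segm_tcont_2d a (p : R * R) : tcont (fun p => segm a (fst p) (snd p)) p.
Proof.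
  unfold segm. apply tcont_plus; [apply tcont_const|].
  apply tcont_mult.
  - apply tcont_RtoC. apply continuous_fst.
  - apply tcont_plus; [apply tcont_snd_Cexp_i|apply tcont_const].
Qed.

(** Contracting the circle to the point [a] along segments does not change the
    integral against Cauchy's kernel, since its derivative in the parameter of
    the contraction is zero. *)
Lemma cauchy_homotopy_fst F a rad :
  1 < rad -> (forall z, Cmod z < rad -> holo_at F z) -> Cmod a < 1 ->
  rmean (fun t => fst (F (Cexp_i t) * ck a t)%C) = rmean (fun t => fst (F a * ck a t)%C).
Proof.
  intros Hrad HF Ha.
  set (psi := fun s => RInt (fun t => fst (F (segm a s t) * ck a t)%C) 0 (2 * PI)).
  assert (D : forall s, 0 <= s <= 1 -> is_derive psi s zero).
  { intros s Hs.
    assert (P3 : 0 < (rad - 1) / 3) by lra.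
    assert (N : forall u, Rabs (u - s) < (rad - 1) / 3 ->
              forall t, Cmod (segm a u t) < rad).
    { intros u Hu t. apply segm_in; auto. apply Rabs_def2 in Hu. lra. }
    assert (X := is_derive_RInt_param
      (fun s t => fst (F (segm a s t) * ck a t)%C) 0 (2 * PI) s).
    assert (E : RInt (fun t => Derive (fun u => fst (F (segm a u t) * ck a t)%C) s)
                  0 (2 * PI) = 0).
    { transitivity (RInt (fun t => fst (C_derive F (segm a s t) * Cexp_i t)%C) 0 (2 * PI)).
      - apply RInt_ext. intros t _. apply is_derive_unique.
        apply segm_derive_l with rad; auto. apply N.
        replace (s - s) with 0 by ring. rewrite Rabs_R0. exact P3.
      - apply (homotopy_derivative_zero F a s rad Hrad HF Ha).
        apply N. replace (s - s) with 0 by ring. rewrite Rabs_R0. exact P3. }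
    change zero with 0. rewrite <- E. apply X; clear X.
    - exists (mkposreal _ P3). intros u Hu t _. eexists.
      apply segm_derive_l with rad; auto.
    - intros t _.
      apply continuity_2d_pt_ext_loc with
        (fun u v => fst (C_derive F (segm a u v) * Cexp_i v)%C).
      + exists (mkposreal _ P3). intros u v Hu _. symmetry.
        apply is_derive_unique. apply segm_derive_l with rad; auto.
      + apply continuity_2d_pt_filterlim.
        assert (T : tcont (fun p : R * R =>
           C_derive F (segm a (fst p) (snd p)) * Cexp_i (snd p))%C (s, t)).
        { apply tcont_mult; [|apply tcont_snd_Cexp_i].
          apply (tcont_comp (C_derive F)); [|apply segm_tcont_2d].
          apply holo_at_derive. apply HF, N. simpl.
          replace (s - s) with 0 by ring. rewrite Rabs_R0. exact P3. }
        exact (proj1 T).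
    - exists (mkposreal _ P3). intros u Hu. apply ex_RInt_cont. intros t.
      assert (T : tcont (fun t => F (segm a u t) * ck a t)%C t).
      { apply tcont_mult; [|now apply tcont_ck].
        apply (tcont_comp F); [|apply segm_tcont_t].
        apply holo_at_ccont, HF, N. exact Hu. }
      exact (proj1 T). }
  assert (E : psi 0 = psi 1) by (apply (eq_is_derive psi); [exact D|lra]).
  unfold rmean. f_equal.
  transitivity (psi 1); [|rewrite <- E]; unfold psi; apply RInt_ext; intros t _;
  unfold segm; do 3 f_equal; ring.
Qed.

Lemma tcont_circle F : (forall z, Cmod z = 1 -> ccont F z) ->
  forall t, tcont (fun t => F (Cexp_i t)) t.
Proof.
  intros H t. apply (tcont_comp F); [|apply tcont_Cexp_i]. apply H, Cmod_Cexp_i.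
Qed.

Lemma holo_tcont_circle F rad : 1 < rad -> (forall z, Cmod z < rad -> holo_at F z) ->
  forall t, tcont (fun t => F (Cexp_i t)) t.
Proof.
  intros Hrad HF. apply tcont_circle. intros z Hz. apply holo_at_ccont, HF. lra.
Qed.

Lemma cauchy_homotopy F a rad :
  1 < rad -> (forall z, Cmod z < rad -> holo_at F z) -> Cmod a < 1 ->
  cmean (fun t => F (Cexp_i t) * ck a t)%C = (F a * cmean (ck a))%C.
Proof.
  intros Hrad HF Ha.
  rewrite <- cmean_scal by (intros; now apply tcont_ck).
  unfold cmean. f_equal; [now apply cauchy_homotopy_fst with rad|].
  assert (X := cauchy_homotopy_fst (fun z => - Ci * F z)%C a rad Hrad).
  assert (E : forall z, snd z = fst (- Ci * z)%C) by (intros; simpl; ring).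
  transitivity (rmean (fun t => fst (- Ci * F (Cexp_i t) * ck a t)%C)).
  { apply rmean_ext. intros. rewrite E. f_equal. ring. }
  rewrite X; [|intros; apply holo_at_mult; [apply holo_at_const|auto]|exact Ha].
  apply rmean_ext. intros. rewrite E. f_equal. ring.
Qed.

Lemma ck_0 t : ck (RtoC 0) t = RtoC 1.
Proof. unfold ck. field. Qed.

Lemma mean_value F rad :
  1 < rad -> (forall z, Cmod z < rad -> holo_at F z) ->
  cmean (fun t => F (Cexp_i t)) = F (RtoC 0).
Proof.
  intros Hrad HF.
  assert (X := cauchy_homotopy F (RtoC 0) rad Hrad HF).
  rewrite Cmod_0 in X. specialize (X Rlt_0_1).
  rewrite (cmean_ext (ck (RtoC 0)) (fun _ => RtoC 1)) in X by (intros; apply ck_0).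
  rewrite cmean_const, Cmult_1_r in X. rewrite <- X.
  apply cmean_ext. intros. rewrite ck_0. ring.
Qed.

Lemma conj_ck_eq a t :
  Cmod a < 1 -> Cconj (ck a t) = (/ (RtoC 1 - Cconj a * Cexp_i t))%C.
Proof.
  intros Ha. unfold ck. rewrite Cinv_conj by now apply ck_den_neq0.
  rewrite Cminus_conj, Cmult_conj, Cconj_conj. f_equal. f_equal.
  unfold RtoC, Cconj. simpl. f_equal. ring.
Qed.

(** The function whose boundary values are the conjugate kernel has its pole
    outside the closed disk. *)
Lemma holo_conj_kernel a z :
  Cmod a < 1 -> Cmod z < 2 / (1 + Cmod a) ->
  (RtoC 1 - Cconj a * z)%C <> RtoC 0 /\
  holo_at (fun z => / (RtoC 1 - Cconj a * z))%C z.
Proof.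
  intros Ha Hz.
  assert (N : (RtoC 1 - Cconj a * z)%C <> RtoC 0).
  { intros H. apply (f_equal Cmod) in H. rewrite Cmod_0 in H.
    generalize (Cmod_rev_triangle (RtoC 1) (Cconj a * z)%C).
    rewrite Cmod_mult, Cmod_conj, Cmod_1.
    generalize (Cmod_ge_0 a) (Cmod_ge_0 z). intros P1 P2.
    apply Rlt_div_r in Hz; [|lra]. nra. }
  split; [exact N|].
  apply holo_at_inv; [|exact N].
  apply holo_at_minus; [apply holo_at_const|].
  apply holo_at_mult; [apply holo_at_const|apply holo_at_id].
Qed.

Lemma conj_kernel_radius a : Cmod a < 1 -> 1 < 2 / (1 + Cmod a).
Proof. intros Ha. apply Rlt_div_r; generalize (Cmod_ge_0 a); lra. Qed.

Lemma cmean_ck a : Cmod a < 1 -> cmean (ck a) = RtoC 1.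
Proof.
  intros Ha.
  assert (X : cmean (fun t => Cconj (ck a t)) = RtoC 1).
  { rewrite (cmean_ext _ (fun t => / (RtoC 1 - Cconj a * Cexp_i t))%C)
      by (intros; now apply conj_ck_eq).
    rewrite (mean_value (fun z => / (RtoC 1 - Cconj a * z))%C (2 / (1 + Cmod a))).
    - field.
    - now apply conj_kernel_radius.
    - intros z Hz. now apply holo_conj_kernel. }
  rewrite cmean_conj in X by (intros; now apply tcont_ck).
  rewrite <- (Cconj_conj (cmean (ck a))), X.
  unfold Cconj, RtoC. simpl. f_equal. ring.
Qed.

Lemma cauchy_formula F a rad :
  1 < rad -> (forall z, Cmod z < rad -> holo_at F z) -> Cmod a < 1 ->
  cmean (fun t => F (Cexp_i t) * ck a t)%C = F a.
Proof.
  intros Hrad HF Ha. rewrite (cauchy_homotopy F a rad) by assumption.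
  rewrite cmean_ck by exact Ha. ring.
Qed.

(** The conjugate kernel is itself the boundary value of a holomorphic function
    with value 1 at 0, so the mean value property applies to the product. *)
Lemma conj_kernel_formula F a rad :
  1 < rad -> (forall z, Cmod z < rad -> holo_at F z) -> Cmod a < 1 ->
  cmean (fun t => F (Cexp_i t) * Cconj (ck a t))%C = F (RtoC 0).
Proof.
  intros Hrad HF Ha.
  rewrite (cmean_ext _ (fun t => F (Cexp_i t) * / (RtoC 1 - Cconj a * Cexp_i t))%C)
      by (intros; now rewrite conj_ck_eq).
  rewrite (mean_value (fun z => F z * / (RtoC 1 - Cconj a * z))%C
            (Rmin rad (2 / (1 + Cmod a)))).
  - field.
  - apply Rmin_glb_lt; [exact Hrad|now apply conj_kernel_radius].
  - intros z Hz. apply holo_at_mult.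
    + apply HF. eapply Rlt_le_trans; [exact Hz|apply Rmin_l].
    + apply holo_conj_kernel; [exact Ha|].
      eapply Rlt_le_trans; [exact Hz|apply Rmin_r].
Qed.

Definition poisson (a : C) (t : R) : R := (1 - Cmod a ^ 2) * Cmod (ck a t) ^ 2.

Lemma Cmod_ck_pos a t : Cmod a < 1 -> 0 < Cmod (ck a t).
Proof.
  intros Ha. unfold ck. rewrite Cmod_inv by now apply ck_den_neq0.
  apply Rinv_0_lt_compat, Cmod_gt_0. now apply ck_den_neq0.
Qed.

Lemma poisson_pos a t : Cmod a < 1 -> 0 < poisson a t.
Proof.
  intros Ha. apply Rmult_lt_0_compat.
  - generalize (Cmod_ge_0 a). nra.
  - now apply pow_lt, Cmod_ck_pos.
Qed.

Lemma poisson_eq a t : Cmod a < 1 ->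
  RtoC (poisson a t) = (ck a t + Cconj (ck a t) - RtoC 1)%C.
Proof.
  intros Ha. unfold poisson.
  rewrite RtoC_mult, RtoC_minus, !Cmod2_conj.
  rewrite conj_ck_eq by exact Ha. unfold ck.
  assert (N1 := ck_den_neq0 a t Ha).
  assert (N2 : (RtoC 1 - Cconj a * Cexp_i t)%C <> RtoC 0).
  { apply holo_conj_kernel; [exact Ha|]. rewrite Cmod_Cexp_i.
    now apply conj_kernel_radius. }
  set (e := Cexp_i t) in *. set (e' := Cconj e) in *. set (a' := Cconj a) in *.
  assert (X : (e * e' = RtoC 1)%C) by apply Cexp_i_conj.
  transitivity ((RtoC 1 - a * a' * (e * e')) * (/ (1 - a * e') * / (1 - a' * e)))%C.
  { rewrite X. ring. }
  field. auto.
Qed.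

Lemma continuous_poisson a t : Cmod a < 1 -> continuous (poisson a) t.
Proof.
  intros Ha. unfold poisson.
  assert (Y := tcont_Cmod (ck a) t (tcont_ck a t Ha)).
  apply (continuous_mult (fun _ => 1 - Cmod a ^ 2) (fun t => Cmod (ck a t) ^ 2));
  [apply continuous_const|].
  apply continuous_ext with (fun t => Cmod (ck a t) * Cmod (ck a t)).
  - intros; simpl; ring.
  - apply (continuous_mult (fun t => Cmod (ck a t)) (fun t => Cmod (ck a t))); exact Y.
Qed.

Lemma poisson_formula F a rad :
  1 < rad -> (forall z, Cmod z < rad -> holo_at F z) -> Cmod a < 1 ->
  cmean (fun t => F (Cexp_i t) * RtoC (poisson a t))%C = F a.
Proof.
  intros Hrad HF Ha.
  assert (TF := holo_tcont_circle F rad Hrad HF).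
  rewrite (cmean_ext _ (fun t => F (Cexp_i t) * ck a t
     + (F (Cexp_i t) * Cconj (ck a t) + - (1) * F (Cexp_i t)))%C)
    by (intros; rewrite poisson_eq by exact Ha; ring).
  rewrite cmean_plus, cmean_plus, cmean_scal.
  - rewrite (cauchy_formula F a rad), (conj_kernel_formula F a rad), (mean_value F rad); auto.
    ring.
  - exact TF.
  - intros. apply tcont_mult; [apply TF|]. now apply tcont_conj, tcont_ck.
  - intros. apply tcont_mult; [apply tcont_const|apply TF].
  - intros. apply tcont_mult; [apply TF|]. now apply tcont_ck.
  - intros. apply tcont_plus.
    + apply tcont_mult; [apply TF|]. now apply tcont_conj, tcont_ck.
    + apply tcont_mult; [apply tcont_const|apply TF].
Qed.

Lemma rmean_poisson a : Cmod a < 1 -> rmean (poisson a) = 1.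
Proof.
  intros Ha. apply RtoC_inj. rewrite <- cmean_RtoC.
  rewrite <- (poisson_formula (fun _ => RtoC 1) a 2); [|lra| |exact Ha].
  - apply cmean_ext. intros. ring.
  - intros. apply holo_at_const.
Qed.

Lemma ck_sub z a t : Cmod z < 1 -> Cmod a < 1 ->
  (ck z t - ck a t)%C = ((z - a) * (Cconj (Cexp_i t) * ck z t * ck a t))%C.
Proof.
  intros Hz Ha. assert (N1 := ck_den_neq0 z t Hz). assert (N2 := ck_den_neq0 a t Ha).
  unfold ck. field. auto.
Qed.

Lemma tcont_conj_Cexp_i t : tcont (fun t => Cconj (Cexp_i t)) t.
Proof. apply tcont_conj, tcont_Cexp_i. Qed.

Lemma tcont_pole (h : R -> C) z a : (forall t, tcont h t) -> Cmod z < 1 -> Cmod a < 1 ->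
  forall t, tcont (fun t => h t * (Cconj (Cexp_i t) * ck z t * ck a t))%C t.
Proof.
  intros Hh Hz Ha t.
  exact (tcont_mult _ _ t (Hh t) (tcont_mult _ _ t (tcont_mult _ _ t
    (tcont_conj_Cexp_i t) (tcont_ck z t Hz)) (tcont_ck a t Ha))).
Qed.

Lemma Cmod_conj_Cexp_i t : Cmod (Cconj (Cexp_i t)) = 1.
Proof. now rewrite Cmod_conj, Cmod_Cexp_i. Qed.

Lemma Cmod_small_eq z w B e0 :
  0 < e0 -> 0 <= B -> (forall e, 0 < e < e0 -> Cmod (z - w)%C <= B * e) -> z = w.
Proof.
  intros He0 HB H. apply NNPP. intros N.
  assert (P : 0 < Cmod (z - w)%C) by (apply Cmod_gt_0; now apply Cminus_eq_contra).
  set (x := Cmod (z - w)%C) in *.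
  assert (Q : 0 < x / (2 * (B + 1))) by (apply Rdiv_lt_0_compat; lra).
  set (e := Rmin (e0 / 2) (x / (2 * (B + 1)))).
  assert (E : 0 < e) by (apply Rmin_pos; lra).
  assert (E1 : e <= e0 / 2) by apply Rmin_l.
  assert (E2 : e <= x / (2 * (B + 1))) by apply Rmin_r.
  specialize (H e (conj E (Rle_lt_trans _ _ _ E1 (Rlt_eps2_eps _ He0)))).
  apply Rle_div_r in E2; [|lra]. nra.
Qed.

(** The limit of the difference quotients of Cauchy's formula. *)
Lemma cauchy_derivative F a rad :
  1 < rad -> (forall z, Cmod z < rad -> holo_at F z) -> Cmod a < 1 ->
  C_derive F a =
  cmean (fun t => F (Cexp_i t) * (Cconj (Cexp_i t) * ck a t * ck a t))%C.
Proof.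
  intros Hrad HF Ha.
  assert (TF := holo_tcont_circle F rad Hrad HF).
  destruct (holo_at_derive F a) as [[q [Eq [Hq Cq]]] _]; [apply HF; lra|].
  set (D := fun z => cmean (fun t => F (Cexp_i t)
               * (Cconj (Cexp_i t) * ck z t * ck a t))%C).
  assert (TD : forall z, Cmod z < 1 -> forall t,
    tcont (fun t => F (Cexp_i t) * (Cconj (Cexp_i t) * ck z t * ck a t))%C t).
  { intros z Hz. exact (tcont_pole _ z a TF Hz Ha). }
  assert (TE : forall z, Cmod z < 1 -> forall t, tcont (fun t => F (Cexp_i t) *
     Cconj (Cexp_i t) * ck a t * (Cconj (Cexp_i t) * ck z t * ck a t))%C t).
  { intros z Hz. apply tcont_pole; [|exact Hz|exact Ha]. intros t.
    exact (tcont_mult _ _ t (tcont_mult _ _ t (TF t) (tcont_conj_Cexp_i t))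
      (tcont_ck a t Ha)). }
  assert (QD : forall z, Cmod z < 1 -> z <> a -> q z = D z).
  { intros z Hz N.
    assert (Nz : (z - a)%C <> RtoC 0) by now apply Cminus_eq_contra.
    assert (X : (q z * (z - a) = D z * (z - a))%C).
    { rewrite <- Eq. unfold D. rewrite (Cmult_comm (cmean _)).
      rewrite <- cmean_scal by now apply TD.
      rewrite <- (cauchy_formula F z rad), <- (cauchy_formula F a rad) by assumption.
      replace (cmean (fun t => F (Cexp_i t) * ck z t)%C
               - cmean (fun t => F (Cexp_i t) * ck a t)%C)%C with
        (cmean (fun t => F (Cexp_i t) * ck z t)%C
               + (- (1)) * cmean (fun t => F (Cexp_i t) * ck a t)%C)%C by ring.
      rewrite <- cmean_scal, <- cmean_plus.
      - apply cmean_ext. intros t _.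
        transitivity (F (Cexp_i t) * (ck z t - ck a t))%C; [ring|].
        rewrite ck_sub by assumption. ring.
      - intros. apply tcont_mult; [apply TF|now apply tcont_ck].
      - intros. apply tcont_mult; [apply tcont_const|].
        apply tcont_mult; [apply TF|now apply tcont_ck].
      - intros. apply tcont_mult; [apply TF|now apply tcont_ck]. }
    transitivity (q z * (z - a) / (z - a))%C; [field; exact Nz|].
    rewrite X. field. exact Nz. }
  set (M := rmean (fun t => Cmod (F (Cexp_i t)))).
  assert (M0 : 0 <= M).
  { rewrite <- (rmean_const 0). apply rmean_le; auto using continuous_const, Cmod_ge_0.
    intros t. apply (tcont_Cmod (fun t => F (Cexp_i t))), TF. }
  set (r := (1 + Cmod a) / 2).
  assert (Hr : Cmod a < r < 1) by (unfold r; lra).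
  set (k := / (1 - r)).
  assert (Hk : 0 < k) by (apply Rinv_0_lt_compat; lra).
  assert (K : forall z t, Cmod z <= r -> Cmod (ck z t) <= k).
  { intros z t Hz. eapply Rle_trans; [apply ck_bound; lra|].
    apply Rinv_le_contravar; lra. }
  assert (DD : forall z, Cmod z <= r ->
            Cmod (D z - D a)%C <= Cmod (z - a)%C * (k * k * k * M)).
  { intros z Hz. unfold D.
    assert (Hz1 : Cmod z < 1) by lra.
    replace (D z - D a)%C with (D z + (- (1)) * D a)%C by ring.
    replace (cmean (fun t => F (Cexp_i t) * (Cconj (Cexp_i t) * ck z t * ck a t))%C
         - cmean (fun t => F (Cexp_i t) * (Cconj (Cexp_i t) * ck a t * ck a t))%C)%C
      with ((z - a) * cmean (fun t => F (Cexp_i t) * Cconj (Cexp_i t) * ck a t *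
               (Cconj (Cexp_i t) * ck z t * ck a t)))%C.
    - rewrite Cmod_mult. apply Rmult_le_compat_l; [apply Cmod_ge_0|].
      unfold M. rewrite <- rmean_scal
        by (intros t; apply (tcont_Cmod (fun t => F (Cexp_i t))), TF).
      apply cmean_norm.
      + exact (TE z Hz1).
      + intros t. apply (continuous_mult (fun _ => k * k * k)); [apply continuous_const|].
        apply (tcont_Cmod (fun t => F (Cexp_i t))), TF.
      + intros t _. rewrite !Cmod_mult, Cmod_conj_Cexp_i.
        rewrite (Rmult_comm (k * k * k)), Rmult_1_r, Rmult_1_l, Rmult_assoc.
        apply Rmult_le_compat_l; [apply Cmod_ge_0|].
        assert (K1 := K z t Hz). assert (K2 := K a t ltac:(lra)).
        generalize (Cmod_ge_0 (ck z t)) (Cmod_ge_0 (ck a t)). intros.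
        rewrite <- Rmult_assoc.
        apply Rmult_le_compat; [apply Rmult_le_pos; assumption|assumption| |exact K2].
        now apply Rmult_le_compat.
    - rewrite <- cmean_scal by exact (TE z Hz1).
      transitivity (cmean (fun t => F (Cexp_i t) * (Cconj (Cexp_i t) * ck z t * ck a t))%C
         + (- (1)) * cmean (fun t => F (Cexp_i t) * (Cconj (Cexp_i t) * ck a t * ck a t)))%C;
      [|ring].
      rewrite <- cmean_scal, <- cmean_plus.
      + apply cmean_ext. intros t _.
        transitivity (F (Cexp_i t) * Cconj (Cexp_i t) * ck a t * (ck z t - ck a t))%C;
        [rewrite ck_sub by assumption; ring|ring].
      + now apply TD.
      + intros t. apply tcont_mult; [apply tcont_const|]. now apply TD.
      + now apply TD. }
  change (cmean _) with (D a). rewrite <- Hq.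
  apply (Cmod_small_eq _ _ 1 1); [lra|lra|].
  intros e He.
  destruct (Cq (e / 2)) as [d [Hd Cd]]; [lra|].
  set (B := k * k * k * M).
  assert (HB : 0 <= B) by exact (Rmult_le_pos _ _ (Rlt_le _ _ (Rmult_lt_0_compat _ _
    (Rmult_lt_0_compat _ _ Hk Hk) Hk)) M0).
  set (h := Rmin (Rmin (d / 2) (r - Cmod a)) (e / 2 / (B + 1))).
  assert (h1 : h <= d / 2) by (eapply Rle_trans; [apply Rmin_l|apply Rmin_l]).
  assert (h2 : h <= r - Cmod a) by (eapply Rle_trans; [apply Rmin_l|apply Rmin_r]).
  assert (h3 : h <= e / 2 / (B + 1)) by apply Rmin_r.
  assert (h0 : 0 < h).
  { repeat apply Rmin_pos; try lra. apply Rdiv_lt_0_compat; lra. }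
  assert (Z : Cmod (a + RtoC h - a)%C = h).
  { replace (a + RtoC h - a)%C with (RtoC h) by ring.
    rewrite Cmod_R, Rabs_pos_eq; lra. }
  assert (Zr : Cmod (a + RtoC h)%C <= r).
  { eapply Rle_trans; [apply Cmod_triangle|]. rewrite Cmod_R, Rabs_pos_eq; lra. }
  assert (ZN : (a + RtoC h)%C <> a).
  { intros E. rewrite E, Cmod_minus_diag in Z. lra. }
  specialize (Cd (a + RtoC h)%C). rewrite Z in Cd. specialize (Cd ltac:(lra)).
  specialize (DD _ Zr). rewrite Z in DD. fold B in DD.
  rewrite QD in Cd by (auto; lra).
  apply Rle_div_r in h3; [|lra].
  generalize (Cmod_sub_triangle (q a) (D (a + RtoC h)%C) (D a)).
  rewrite (Cmod_minus_sym (q a) (D (a + RtoC h)%C)). nra.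
Qed.

(** Adding the vanishing integral of the conjugate of [F] leaves only the real
    part of [F], whose weighted mean is controlled by Poisson's formula. *)
Lemma derivative_le_Re_closed F a rad :
  1 < rad -> (forall z, Cmod z < rad -> holo_at F z) -> Cmod a < 1 ->
  (forall t, 0 <= fst (F (Cexp_i t))) ->
  Cmod (C_derive F a) * (1 - Cmod a ^ 2) <= 2 * fst (F a).
Proof.
  intros Hrad HF Ha Hpos.
  assert (TF := holo_tcont_circle F rad Hrad HF).
  assert (Z : cmean (fun t => Cconj (F (Cexp_i t)) *
                 (Cconj (Cexp_i t) * ck a t * ck a t))%C = RtoC 0).
  { rewrite (cmean_ext _ (fun t => Cconj (F (Cexp_i t) * Cexp_i t *
       / (RtoC 1 - Cconj a * Cexp_i t) * Cconj (ck a t))))%C.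
    - rewrite cmean_conj.
      + rewrite (conj_kernel_formula (fun z => F z * z * / (RtoC 1 - Cconj a * z))%C a
                 (Rmin rad (2 / (1 + Cmod a)))).
        * unfold Cconj, RtoC, Cmult. simpl. f_equal; ring.
        * apply Rmin_glb_lt; [exact Hrad|now apply conj_kernel_radius].
        * intros z Hz. repeat apply holo_at_mult.
          -- apply HF. eapply Rlt_le_trans; [exact Hz|apply Rmin_l].
          -- apply holo_at_id.
          -- apply holo_conj_kernel; [exact Ha|].
             eapply Rlt_le_trans; [exact Hz|apply Rmin_r].
        * exact Ha.
      + intros t. apply tcont_mult; [|now apply tcont_conj, tcont_ck].
        apply tcont_mult; [apply tcont_mult; [apply TF|apply tcont_Cexp_i]|].
        apply (tcont_comp (fun z => / (RtoC 1 - Cconj a * z))%C); [|apply tcont_Cexp_i].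
        apply holo_at_ccont, holo_conj_kernel; [exact Ha|].
        rewrite Cmod_Cexp_i. now apply conj_kernel_radius.
    - intros t _. rewrite <- (conj_ck_eq a t Ha), !Cmult_conj, !Cconj_conj. ring. }
  assert (Y : C_derive F a = cmean (fun t => RtoC (2 * fst (F (Cexp_i t))) *
                 (Cconj (Cexp_i t) * ck a t * ck a t))%C).
  { rewrite (cauchy_derivative F a rad) by assumption.
    rewrite <- (Cplus_0_r (cmean _)), <- Z, <- cmean_plus.
    - apply cmean_ext. intros t _. rewrite RtoC_mult.
      replace (RtoC (fst (F (Cexp_i t)))) with
        ((F (Cexp_i t) + Cconj (F (Cexp_i t))) / RtoC 2)%C; [|symmetry; apply re_alt].
      field.
    - apply (tcont_pole (fun t => F (Cexp_i t))); assumption.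
    - apply (tcont_pole (fun t => Cconj (F (Cexp_i t)))); [|exact Ha|exact Ha].
      intros t. exact (tcont_conj _ t (TF t)). }
  assert (T2 : forall t, tcont (fun t => RtoC (2 * fst (F (Cexp_i t)))) t).
  { intros t. apply tcont_RtoC. apply (continuous_mult (fun _ => 2));
    [apply continuous_const|exact (proj1 (TF t))]. }
  assert (CR : forall t, continuous (fun t => fst (F (Cexp_i t))) t)
    by (intros t; exact (proj1 (TF t))).
  assert (CP : forall t, continuous (fun t => fst (F (Cexp_i t)) * poisson a t) t).
  { intros t. apply (continuous_mult (fun t => fst (F (Cexp_i t))) (poisson a));
    [apply CR|now apply continuous_poisson]. }
  assert (V : rmean (fun t => 2 * (fst (F (Cexp_i t)) * poisson a t)) = 2 * fst (F a)).
  { rewrite rmean_scal by exact CP. f_equal.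
    rewrite <- (poisson_formula F a rad) by assumption. unfold cmean. simpl.
    apply rmean_ext. intros. ring. }
  rewrite <- V.
  assert (Q : 0 < 1 - Cmod a ^ 2) by (generalize (Cmod_ge_0 a); nra).
  rewrite Y. rewrite Rmult_comm.
  replace (1 - Cmod a ^ 2) with (Cmod (RtoC (1 - Cmod a ^ 2)))
    by (rewrite Cmod_R; apply Rabs_pos_eq; lra).
  rewrite <- Cmod_mult, <- cmean_scal.
  - apply cmean_norm.
    + intros t. exact (tcont_mult _ _ t (tcont_const _ t) (tcont_pole _ a a T2 Ha Ha t)).
    + intros t. apply (continuous_mult (fun _ => 2)); [apply continuous_const|]. apply CP.
    + intros t _. rewrite !Cmod_mult, !Cmod_R, Cmod_conj_Cexp_i.
      rewrite !Rabs_pos_eq; [|generalize (Hpos t); lra|lra].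
      unfold poisson. right. ring.
  - exact (tcont_pole _ a a T2 Ha Ha).
Qed.

(** * Holomorphic functions on the open disk *)

Definition holo_disk (F : C -> C) : Prop := forall z, in_disk z -> holo_at F z.

(** Formulas on the closed disk are applied to the dilations [F (rho * z)]; this
    lemma lets [rho] tend to 1. *)
Lemma le_of_mult_lt1 A B x :
  x < 1 -> 0 <= A -> (forall rho, x < rho < 1 -> A * rho <= B) -> A <= B.
Proof.
  intros Hx HA H. apply Rnot_lt_le. intros N.
  set (u := (x + 1) / 2). set (v := (1 + B / A) / 2).
  assert (0 < A).
  { destruct HA as [HA|HA]; [exact HA|]. subst A.
    generalize (H u ltac:(unfold u; lra)). lra. }
  assert (Hv : v < 1).
  { unfold v. assert (B / A < 1) by (apply Rlt_div_l; lra). lra. }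
  assert (Hu : x < u < 1) by (unfold u; lra).
  specialize (H (Rmax u v)).
  assert (L : x < Rmax u v < 1).
  { split; [eapply Rlt_le_trans; [apply Hu|apply Rmax_l]|]. apply Rmax_lub_lt; lra. }
  specialize (H L).
  assert (W : A * v <= A * Rmax u v) by (apply Rmult_le_compat_l; [lra|apply Rmax_r]).
  assert (A * v = (A + B) / 2) by (unfold v; field; lra). lra.
Qed.

Lemma Cmod_scal_lt rho z : 0 < rho -> Cmod z < / rho -> Cmod (RtoC rho * z)%C < 1.
Proof.
  intros Hr Hz. rewrite Cmod_mult, Cmod_R, Rabs_pos_eq by lra.
  apply (Rmult_lt_compat_l rho) in Hz; [|exact Hr]. rewrite Rinv_r in Hz; lra.
Qed.

Lemma holo_dilate F rho z : holo_disk F -> 0 < rho -> Cmod z < / rho ->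
  holo_at (fun w => F (RtoC rho * w)%C) z.
Proof.
  intros HF Hr Hz.
  apply (holo_at_comp F (fun w => RtoC rho * w)%C).
  - apply HF. now apply Cmod_scal_lt.
  - apply holo_at_mult; [apply holo_at_const|apply holo_at_id].
Qed.

Lemma inv_gt1 rho : 0 < rho < 1 -> 1 < / rho.
Proof. intros H. rewrite <- Rinv_1. apply Rinv_lt_contravar; lra. Qed.

Lemma Cmod_div_RtoC z rho : 0 < rho -> Cmod (z / RtoC rho)%C = Cmod z / rho.
Proof.
  intros H. rewrite Cmod_div, Cmod_R, Rabs_pos_eq by (try intros E; try apply RtoC_inj in E; lra).
  reflexivity.
Qed.

Lemma RtoC_neq0 x : x <> 0 -> RtoC x <> RtoC 0.
Proof. intros H E. apply H. now apply RtoC_inj. Qed.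

Lemma derivative_le_Re P a :
  holo_disk P -> (forall z, in_disk z -> 0 <= fst (P z)) -> in_disk a ->
  Cmod (C_derive P a) * (1 - Cmod a ^ 2) <= 2 * fst (P a).
Proof.
  intros HP Hpos Ha. unfold in_disk in Ha.
  generalize (Cmod_ge_0 a) (Cmod_ge_0 (C_derive P a)). intros A0 D0.
  set (D := Cmod (C_derive P a)) in *.
  assert (X : forall rho, Cmod a < rho < 1 ->
     D * (rho * rho - Cmod a ^ 2) <= 2 * fst (P a)).
  { intros rho Hr.
    assert (Rr : RtoC rho <> RtoC 0) by (apply RtoC_neq0; lra).
    assert (E : (RtoC rho * (a / RtoC rho) = a)%C) by (field; exact Rr).
    assert (L : Cmod (a / RtoC rho)%C = Cmod a / rho) by (apply Cmod_div_RtoC; lra).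
    assert (L1 : Cmod (a / RtoC rho)%C < 1) by (rewrite L; apply Rlt_div_l; lra).
    assert (Y := derivative_le_Re_closed (fun w => P (RtoC rho * w)%C)
       (a / RtoC rho)%C (/ rho) (inv_gt1 rho ltac:(lra))
       (fun z Hz => holo_dilate P rho z HP ltac:(lra) Hz) L1).
    rewrite (cderiv_C_derive _ _ (C_derive P a * RtoC rho)%C) in Y.
    - rewrite Cmod_mult, Cmod_R, Rabs_pos_eq, L, E in Y by lra. fold D in Y.
      assert (Z : D * rho * (1 - (Cmod a / rho) ^ 2) <= 2 * fst (P a)).
      { apply Y. intros t. apply Hpos. apply Cmod_scal_lt; [lra|].
        rewrite Cmod_Cexp_i. apply inv_gt1; lra. }
      replace (D * rho * (1 - (Cmod a / rho) ^ 2)) with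
        (D * (rho * rho - Cmod a ^ 2) / rho) in Z by (field; lra).
      apply (proj1 (Rle_div_l _ _ rho ltac:(lra))) in Z.
      assert (0 <= fst (P a)) by now apply Hpos. nra.
    - apply (cderiv_comp P (fun w => RtoC rho * w)%C).
      + rewrite E. apply holo_at_derive. now apply HP.
      + apply cderiv_scal. }
  (* [2 * rho - 1 <= rho ^ 2] makes the bound linear in [rho]. *)
  assert (W : D * 2 <= 2 * fst (P a) + D * Cmod a ^ 2 + D).
  { apply (le_of_mult_lt1 _ _ (Cmod a)); [exact Ha|lra|].
    intros rho Hr. specialize (X rho Hr).
    assert (D * (2 * rho - 1) <= D * (rho * rho)) by (apply Rmult_le_compat_l; nra).
    lra. }
  lra.
Qed.

(** The kernel of [conj_kernel_formula] annihilates a function vanishing at 0,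
    which turns Cauchy's kernel into Poisson's and exhibits [F z / z] as the
    Poisson mean of its boundary values. *)
Lemma quotient_formula F a rad :
  1 < rad -> (forall z, Cmod z < rad -> holo_at F z) -> F (RtoC 0) = RtoC 0 ->
  Cmod a < 1 ->
  F a = (a * cmean (fun t => F (Cexp_i t) * Cconj (Cexp_i t) * RtoC (poisson a t)))%C.
Proof.
  intros Hrad HF H0 Ha.
  assert (TF := holo_tcont_circle F rad Hrad HF).
  assert (T1 : forall t, tcont (fun t => F (Cexp_i t) * ck a t)%C t).
  { intros t. apply tcont_mult; [apply TF|now apply tcont_ck]. }
  assert (T2 : forall t, tcont (fun t => F (Cexp_i t) * Cconj (ck a t))%C t).
  { intros t. apply tcont_mult; [apply TF|now apply tcont_conj, tcont_ck]. }
  assert (T3 : forall t, tcont (fun t => F (Cexp_i t) * Cconj (Cexp_i t)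
                     * RtoC (poisson a t))%C t).
  { intros t. apply tcont_mult; [apply tcont_mult; [apply TF|apply tcont_conj_Cexp_i]|].
    now apply tcont_RtoC, continuous_poisson. }
  rewrite <- cmean_scal by exact T3.
  rewrite (cmean_ext _ (fun t => F (Cexp_i t) * ck a t + (- (1) * F (Cexp_i t)
              + a * Cconj a * (F (Cexp_i t) * Cconj (ck a t))))%C).
  - rewrite cmean_plus, cmean_plus, !cmean_scal; auto.
    + rewrite (cauchy_formula F a rad), (conj_kernel_formula F a rad), (mean_value F rad)
        by assumption. rewrite H0. ring.
    + intros t. apply tcont_mult; [apply tcont_const|apply TF].
    + intros t. apply tcont_mult; [apply tcont_const|apply T2].
    + intros t. apply tcont_plus; apply tcont_mult; auto using tcont_const.
  - intros t _. rewrite poisson_eq by exact Ha. rewrite (conj_ck_eq a t Ha).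
    assert (N1 := ck_den_neq0 a t Ha).
    assert (N2 : (RtoC 1 - Cconj a * Cexp_i t)%C <> RtoC 0).
    { apply holo_conj_kernel; [exact Ha|]. rewrite Cmod_Cexp_i.
      now apply conj_kernel_radius. }
    assert (X := Cexp_i_conj t). unfold ck.
    set (e := Cexp_i t) in *. set (e' := Cconj e) in *. set (a' := Cconj a) in *.
    assert (Y : (a * e' * (/ (1 - a * e') + / (1 - a' * e) - 1)
      = / (1 - a * e') - 1 + a * a' * (e * e') * / (1 - a' * e))%C) by (field; auto).
    rewrite X in Y.
    transitivity (F e * (a * e' * (/ (1 - a * e') + / (1 - a' * e) - 1)))%C; [ring|].
    rewrite Y. ring.
Qed.

Lemma poisson_0 t : poisson (RtoC 0) t = 1.
Proof. unfold poisson. rewrite ck_0, Cmod_0, Cmod_1. ring. Qed.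

Lemma derivative_0_formula F rad :
  1 < rad -> (forall z, Cmod z < rad -> holo_at F z) ->
  C_derive F (RtoC 0) =
  cmean (fun t => F (Cexp_i t) * Cconj (Cexp_i t) * RtoC (poisson (RtoC 0) t))%C.
Proof.
  intros Hrad HF. rewrite (cauchy_derivative F (RtoC 0) rad);
  [|assumption|assumption|rewrite Cmod_0; lra].
  apply cmean_ext. intros t _. rewrite ck_0, poisson_0. ring.
Qed.

Lemma schwarz W : holo_disk W -> W (RtoC 0) = RtoC 0 ->
  (forall z, in_disk z -> Cmod (W z) <= 1) ->
  forall z, in_disk z -> Cmod (W z) <= Cmod z.
Proof.
  intros HW W0 W1 z Hz.
  generalize (Cmod_ge_0 z). intros Z0. unfold in_disk in Hz.
  apply (le_of_mult_lt1 _ _ (Cmod z)); [exact Hz|apply Cmod_ge_0|].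
  intros rho Hr.
  assert (Rr : RtoC rho <> RtoC 0) by (apply RtoC_neq0; lra).
  assert (L : Cmod (z / RtoC rho)%C = Cmod z / rho) by (apply Cmod_div_RtoC; lra).
  assert (L1 : Cmod (z / RtoC rho)%C < 1) by (rewrite L; apply Rlt_div_l; lra).
  assert (HG : forall w, Cmod w < / rho -> holo_at (fun w => W (RtoC rho * w)%C) w)
    by (intros; apply holo_dilate; auto; lra).
  assert (Hi := inv_gt1 rho ltac:(lra)).
  assert (X := quotient_formula (fun w => W (RtoC rho * w)%C) (z / RtoC rho)%C
    (/ rho) Hi HG).
  cbv beta in X. rewrite Cmult_0_r in X. specialize (X W0 L1).
  replace (RtoC rho * (z / RtoC rho))%C with z in X by (field; exact Rr).
  rewrite X, Cmod_mult, L.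
  set (m := cmean _).
  assert (M : Cmod m <= 1).
  { rewrite <- (rmean_poisson (z / RtoC rho)%C L1). apply cmean_norm.
    - intros t. apply tcont_mult.
      + apply tcont_mult; [|apply tcont_conj_Cexp_i].
        apply (holo_tcont_circle (fun w => W (RtoC rho * w)%C) (/ rho)); auto.
      + now apply tcont_RtoC, continuous_poisson.
    - intros t. now apply continuous_poisson.
    - intros t _. rewrite !Cmod_mult, Cmod_conj_Cexp_i, Cmod_R.
      assert (P := poisson_pos _ t L1). rewrite Rabs_pos_eq by lra.
      rewrite Rmult_1_r. rewrite <- (Rmult_1_l (poisson _ t)) at 2.
      apply Rmult_le_compat_r; [lra|]. apply W1. apply Cmod_scal_lt; [lra|].
      now rewrite Cmod_Cexp_i. }
  generalize (Cmod_ge_0 m). intros.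
  replace (Cmod z / rho * Cmod m * rho) with (Cmod z * Cmod m) by (field; lra).
  nra.
Qed.

Lemma Re_conj_mult_eq1 c q :
  Cmod c = 1 -> Cmod q <= 1 -> fst (Cconj c * q)%C = 1 -> q = c.
Proof.
  intros Hc Hq H. destruct c as [c1 c2]. destruct q as [q1 q2]. simpl in H.
  assert (C2 := Cmod2_alt (c1, c2)). rewrite Hc in C2. simpl in C2.
  assert (Q2 := Cmod2_alt (q1, q2)). simpl in Q2.
  generalize (Cmod_ge_0 (q1, q2)). intros Q0.
  assert (Q1 : Cmod (q1, q2) * Cmod (q1, q2) <= 1) by nra.
  assert (S : (q1 - c1) * (q1 - c1) + (q2 - c2) * (q2 - c2) <= 0) by lra.
  generalize (Rle_0_sqr (q1 - c1)) (Rle_0_sqr (q2 - c2)). unfold Rsqr. intros S1 S2.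
  assert (D1 : q1 - c1 = 0) by (apply Rsqr_0_uniq; unfold Rsqr; lra).
  assert (D2 : q2 - c2 = 0) by (apply Rsqr_0_uniq; unfold Rsqr; lra).
  f_equal; lra.
Qed.

(** The function [1 - Re (Cconj c * h)] is continuous and nonnegative with Poisson
    mean 0, hence vanishes, and [Re (Cconj c * h) = 1] forces [h = c]. *)
Lemma poisson_mean_extremal (h : R -> C) a c :
  Cmod a < 1 -> Cmod c = 1 -> (forall t, tcont h t) -> (forall t, Cmod (h t) <= 1) ->
  cmean (fun t => h t * RtoC (poisson a t))%C = c ->
  forall t, 0 < t < 2 * PI -> h t = c.
Proof.
  intros Ha Hc Th H1 E t Ht.
  set (g := fun t => fst (Cconj c * h t)%C).
  assert (Tg : forall t, continuous g t).
  { intros s. exact (proj1 (tcont_mult (fun _ => Cconj c) h s (tcont_const _ s) (Th s))). }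
  assert (G1 : forall t, g t <= 1).
  { intros s. unfold g. eapply Rle_trans; [apply Rle_abs|].
    eapply Rle_trans; [apply re_le_Cmod|].
    rewrite Cmod_mult, Cmod_conj, Hc. generalize (H1 s). lra. }
  assert (Tp : forall t, continuous (poisson a) t) by (intros; now apply continuous_poisson).
  assert (Tgp : forall t, continuous (fun t => g t * poisson a t) t).
  { intros s. apply (continuous_mult g (poisson a)); auto. }
  assert (Thp : forall t, tcont (fun t => h t * RtoC (poisson a t))%C t).
  { intros s. apply tcont_mult; [apply Th|now apply tcont_RtoC]. }
  assert (M : rmean (fun t => g t * poisson a t) = 1).
  { transitivity (fst (Cconj c * c)%C).
    - rewrite <- E at 2. rewrite <- cmean_scal by exact Thp. unfold cmean. simpl.
      apply rmean_ext. intros. unfold g. simpl. ring.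
    - rewrite Cmult_comm, <- Cmod2_conj, Hc. simpl. ring. }
  assert (Z : (1 - g t) * poisson a t = 0).
  { apply (rmean_nonneg_eq0 (fun t => (1 - g t) * poisson a t)).
    - intros s. apply (continuous_mult (fun t => 1 - g t) (poisson a)); [|apply Tp].
      apply (continuous_minus (fun _ => 1) g); [apply continuous_const|apply Tg].
    - intros s _. apply Rmult_le_pos; [generalize (G1 s); lra|].
      left. now apply poisson_pos.
    - rewrite (rmean_ext _ (fun t => poisson a t + (-1) * (g t * poisson a t)))
        by (intros; ring).
      rewrite rmean_plus, rmean_scal, rmean_poisson, M; auto; [ring|].
      intros s. apply (continuous_mult (fun _ => -1)); [apply continuous_const|apply Tgp].
    - exact Ht. }
  apply Rmult_integral in Z. destruct Z as [Z|Z].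
  - apply Re_conj_mult_eq1; auto. fold (g t). lra.
  - generalize (poisson_pos a t Ha). lra.
Qed.

(** On a circle enclosing [z0] and [z], the number [c] is a Poisson mean of
    the values of [W w / w], which lie in the closed unit disk.  They are thus
    all equal to [c], and so is their Poisson mean at [z].  The derivative at 0
    is the value of [W w / w] at [z0 = 0]. *)
Lemma schwarz_rigid W z0 c : holo_disk W -> W (RtoC 0) = RtoC 0 ->
  (forall z, in_disk z -> Cmod (W z) <= 1) -> in_disk z0 -> Cmod c = 1 ->
  (z0 = RtoC 0 /\ C_derive W (RtoC 0) = c \/ z0 <> RtoC 0 /\ W z0 = (c * z0)%C) ->
  forall z, in_disk z -> W z = (c * z)%C.
Proof.
  intros HW W0 W1 Hz0 Hc Hcase z Hz. unfold in_disk in *.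
  set (m := Rmax (Cmod z) (Cmod z0)).
  assert (Hm : m < 1) by now apply Rmax_lub_lt.
  assert (M1 : Cmod z <= m) by apply Rmax_l.
  assert (M2 : Cmod z0 <= m) by apply Rmax_r.
  generalize (Cmod_ge_0 z) (Cmod_ge_0 z0). intros Pz Pz0.
  set (rho := (m + 1) / 2).
  assert (Hr : m < rho < 1) by (unfold rho; lra).
  assert (Rr : RtoC rho <> RtoC 0) by (apply RtoC_neq0; lra).
  set (G := fun w => W (RtoC rho * w)%C).
  assert (HG : forall w, Cmod w < / rho -> holo_at G w)
    by (intros; apply holo_dilate; auto; lra).
  assert (Hi := inv_gt1 rho ltac:(lra)).
  assert (G0 : G (RtoC 0) = RtoC 0) by (unfold G; now rewrite Cmult_0_r).
  assert (L : forall v, Cmod v <= m -> Cmod (v / RtoC rho)%C < 1).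
  { intros v Hv. rewrite Cmod_div_RtoC by lra. apply Rlt_div_l; lra. }
  set (h := fun t => (G (Cexp_i t) * Cconj (Cexp_i t) / RtoC rho)%C).
  assert (TG := holo_tcont_circle G (/ rho) Hi HG).
  assert (TGc : forall t, tcont (fun t => G (Cexp_i t) * Cconj (Cexp_i t))%C t).
  { intros t. apply tcont_mult; [apply TG|apply tcont_conj_Cexp_i]. }
  assert (Th : forall t, tcont h t).
  { intros t. apply tcont_mult; [apply TGc|apply tcont_const]. }
  assert (S : forall v, Cmod v < 1 ->
     cmean (fun t => h t * RtoC (poisson v t))%C =
     (/ RtoC rho * cmean (fun t => G (Cexp_i t) * Cconj (Cexp_i t) * RtoC (poisson v t)))%C).
  { intros v Hv. rewrite <- cmean_scal.
    - apply cmean_ext. intros. unfold h. field. exact Rr.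
    - intros t. apply tcont_mult; [apply TGc|]. now apply tcont_RtoC, continuous_poisson. }
  assert (H1 : forall t, Cmod (h t) <= 1).
  { intros t. unfold h. rewrite Cmod_div_RtoC by lra.
    rewrite Cmod_mult, Cmod_conj_Cexp_i, Rmult_1_r. apply Rle_div_l; [lra|].
    rewrite Rmult_1_l. unfold G.
    replace rho with (Cmod (RtoC rho * Cexp_i t)%C) at 2.
    - apply schwarz; auto. apply Cmod_scal_lt; [lra|]. now rewrite Cmod_Cexp_i.
    - rewrite Cmod_mult, Cmod_Cexp_i, Cmod_R, Rabs_pos_eq; lra. }
  assert (Hc0 : cmean (fun t => h t * RtoC (poisson (z0 / RtoC rho) t))%C = c).
  { rewrite S by now apply L.
    destruct Hcase as [[-> E]|[N E]].
    - replace (RtoC 0 / RtoC rho)%C with (RtoC 0) by (field; exact Rr).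
      rewrite <- (derivative_0_formula G (/ rho)) by assumption.
      rewrite (cderiv_C_derive G (RtoC 0) (c * RtoC rho)%C).
      + field. exact Rr.
      + apply (cderiv_comp W (fun w => RtoC rho * w)%C).
        * rewrite Cmult_0_r, <- E. apply holo_at_derive, HW.
          unfold in_disk. rewrite Cmod_0. lra.
        * apply cderiv_scal.
    - assert (Q := quotient_formula G (z0 / RtoC rho)%C (/ rho) Hi HG G0 (L z0 M2)).
      unfold G at 1 in Q.
      replace (RtoC rho * (z0 / RtoC rho))%C with z0 in Q by (field; exact Rr).
      rewrite E in Q. set (x := cmean _) in *.
      transitivity (c * z0 / z0)%C; [rewrite Q; field; auto|field; auto]. }
  assert (HC := poisson_mean_extremal h _ c (L z0 M2) Hc Th H1 Hc0).
  assert (Hc1 : cmean (fun t => h t * RtoC (poisson (z / RtoC rho) t))%C = c).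
  { transitivity (cmean (fun t => c * RtoC (poisson (z / RtoC rho) t)))%C.
    - unfold cmean, rmean. f_equal; f_equal; apply RInt_ext;
      rewrite Rmin_left, Rmax_right by (generalize two_PI_pos; lra);
      intros t Ht; now rewrite HC.
    - rewrite cmean_scal by (intros; now apply tcont_RtoC, continuous_poisson, L).
      rewrite cmean_RtoC, rmean_poisson by now apply L. ring. }
  rewrite S in Hc1 by now apply L.
  assert (Q := quotient_formula G (z / RtoC rho)%C (/ rho) Hi HG G0 (L z M1)).
  unfold G at 1 in Q.
  replace (RtoC rho * (z / RtoC rho))%C with z in Q by (field; exact Rr).
  rewrite Q, <- Hc1. field. exact Rr.
Qed.

(** * The minimum principle and injective functions *)

(** The mean value property of [1 / F]. *)
Lemma minimum_principle F a tau tau' m :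
  0 < tau < tau' ->
  (forall w, Cmod (w - a)%C < tau' -> holo_at F w /\ F w <> RtoC 0) ->
  0 < m ->
  (forall t, 0 <= t <= 2 * PI -> m <= Cmod (F (a + RtoC tau * Cexp_i t)%C)) ->
  m <= Cmod (F a).
Proof.
  intros Ht HF Hm H.
  set (G := fun z => (/ F (a + RtoC tau * z))%C).
  assert (In : forall z, Cmod z < tau' / tau -> Cmod (a + RtoC tau * z - a)%C < tau').
  { intros z Hz. replace (a + RtoC tau * z - a)%C with (RtoC tau * z)%C by ring.
    rewrite Cmod_mult, Cmod_R, Rabs_pos_eq by lra.
    apply Rlt_div_r in Hz; lra. }
  assert (HG : forall z, Cmod z < tau' / tau -> holo_at G z).
  { intros z Hz. apply holo_at_inv; [|now apply HF, In].
    apply (holo_at_comp F (fun z => a + RtoC tau * z)%C); [now apply HF, In|].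
    apply holo_at_plus; [apply holo_at_const|].
    apply holo_at_mult; [apply holo_at_const|apply holo_at_id]. }
  assert (R1 : 1 < tau' / tau) by (apply Rlt_div_r; lra).
  assert (X := mean_value G _ R1 HG). unfold G in X at 2.
  rewrite Cmult_0_r, Cplus_0_r in X.
  assert (N : F a <> RtoC 0).
  { apply HF. rewrite Cmod_minus_diag. lra. }
  assert (B : Cmod (/ F a)%C <= / m).
  { rewrite <- X, <- (rmean_const (/ m)). apply cmean_norm.
    - apply (holo_tcont_circle G _ R1 HG).
    - intros. apply continuous_const.
    - intros t Htt. unfold G. rewrite Cmod_inv.
      + apply Rinv_le_contravar; auto.
      + apply HF, In. rewrite Cmod_Cexp_i. exact R1. }
  rewrite Cmod_inv in B by exact N.
  assert (0 < Cmod (F a)) by now apply Cmod_gt_0.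
  rewrite <- (Rinv_inv m), <- (Rinv_inv (Cmod (F a))).
  apply Rinv_le_contravar; [now apply Rinv_0_lt_compat|exact B].
Qed.

Lemma circle_min (h : R -> R) :
  (forall t, continuous h t) -> (forall t, 0 < h t) ->
  exists m, 0 < m /\ forall t, 0 <= t <= 2 * PI -> m <= h t.
Proof.
  intros Ch Ph.
  destruct (continuity_ab_min h 0 (2 * PI)) as [x [Hx _]].
  - generalize two_PI_pos. lra.
  - intros c _. apply continuity_pt_filterlim, Ch.
  - exists (h x). auto.
Qed.

Lemma tcont_on_circle F a tau :
  (forall t, ccont F (a + RtoC tau * Cexp_i t)%C) ->
  forall t, tcont (fun t => F (a + RtoC tau * Cexp_i t)%C) t.
Proof.
  intros H t. apply (tcont_comp F); [apply H|].
  apply tcont_plus; [apply tcont_const|].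
  apply tcont_mult; [apply tcont_const|apply tcont_Cexp_i].
Qed.

Lemma Cmod_circle a tau t :
  0 < tau -> Cmod (a + RtoC tau * Cexp_i t - a)%C = tau.
Proof.
  intros H. replace (a + RtoC tau * Cexp_i t - a)%C with (RtoC tau * Cexp_i t)%C by ring.
  rewrite Cmod_mult, Cmod_R, Cmod_Cexp_i, Rabs_pos_eq; lra.
Qed.

(** Were the value [f y], close to [f b], not taken near [b], the minimum
    principle for [f - f y] on a small disk about [b] would fail. *)
Lemma inverse_continuous f b :
  holo_disk f -> univalent_on_disk f -> in_disk b ->
  forall eps, 0 < eps -> exists d, 0 < d /\
    forall y, in_disk y -> Cmod (f y - f b)%C < d -> Cmod (y - b)%C < eps.
Proof.
  intros Hf Uf Hb eps He. unfold in_disk in Hb.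
  set (tau' := Rmin eps (1 - Cmod b)).
  assert (T0 : 0 < tau') by (apply Rmin_pos; lra).
  assert (T1 : tau' <= eps) by apply Rmin_l.
  assert (T2 : tau' <= 1 - Cmod b) by apply Rmin_r.
  assert (In : forall w, Cmod (w - b)%C < tau' -> in_disk w).
  { intros w Hw. unfold in_disk. generalize (Cmod_rev_triangle w b). lra. }
  set (tau := tau' / 2). assert (Ht : 0 < tau < tau') by (unfold tau; lra).
  assert (Ic : forall t, in_disk (b + RtoC tau * Cexp_i t)%C).
  { intros t. apply In. rewrite Cmod_circle; lra. }
  assert (Tc : forall t, tcont (fun t => f (b + RtoC tau * Cexp_i t) - f b)%C t).
  { apply (tcont_on_circle (fun z => f z - f b)%C). intros t.
    apply holo_at_ccont, holo_at_minus; [apply Hf, Ic|apply holo_at_const]. }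
  destruct (circle_min (fun t => Cmod (f (b + RtoC tau * Cexp_i t) - f b)%C))
    as [m [Hm Hmin]].
  { intros t. apply (tcont_Cmod (fun t => f (b + RtoC tau * Cexp_i t) - f b)%C), Tc. }
  { intros t. apply Cmod_gt_0, Cminus_eq_contra. intros E.
    apply Uf in E; [|apply Ic|exact Hb].
    assert (X := Cmod_circle b tau t ltac:(lra)).
    rewrite E, Cmod_minus_diag in X. lra. }
  exists (m / 2). split; [lra|]. intros y Hy Hd.
  destruct (classic (exists w, Cmod (w - b)%C < tau' /\ f w = f y)) as [[w [Hw E]]|N].
  - apply Uf in E; [|now apply In|exact Hy]. subst w. lra.
  - exfalso.
    assert (X : m / 2 <= Cmod (f b - f y)%C).
    { apply (minimum_principle (fun z => f z - f y)%C b tau tau'); [exact Ht| |lra|].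
      - intros w Hw. split.
        + apply holo_at_minus; [now apply Hf, In|apply holo_at_const].
        + intros E. apply N. exists w. split; [exact Hw|]. now apply Ceq_minus.
      - intros t Htt. specialize (Hmin t Htt).
        generalize (Cmod_sub_triangle (f (b + RtoC tau * Cexp_i t)%C) (f y) (f b)). lra. }
    rewrite Cmod_minus_sym in X. lra.
Qed.

(** * Convergent power series *)

(** [cseries] and [cps] fix the structure of normed module that carries the
    power series defining analyticity. *)
Definition cseries (T : nat -> C) (l : C) : Prop :=
  @is_series C_AbsRing C_NormedModule T l.

Lemma bounded_of_eventually (u : nat -> R) N M :
  (forall n, (N <= n)%nat -> u n <= M) -> exists M', forall n, u n <= M'.
Proof.
  revert M. induction N as [|N IH]; intros M H.
  - exists M. intros. apply H. lia.
  - apply (IH (Rmax M (u N))). intros n Hn.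
    destruct (Nat.eq_dec n N) as [->|]; [apply Rmax_r|].
    eapply Rle_trans; [apply H; lia|apply Rmax_l].
Qed.

Lemma cseries_terms_bounded T l :
  cseries T l -> exists M, forall n, Cmod (T n) <= M.
Proof.
  intros H. unfold cseries, is_series in H.
  assert (X := proj1 (filterlim_locally_ball_norm _ _) H (mkposreal 1 Rlt_0_1)).
  destruct X as [N HN].
  apply (bounded_of_eventually _ (S N) 2). intros [|n] Hn; [lia|].
  assert (A : Cmod (sum_n T (S n) - l)%C < 1) by (apply (HN (S n)); lia).
  assert (B : Cmod (sum_n T n - l)%C < 1) by (apply (HN n); lia).
  rewrite sum_Sn in A.
  change (plus (sum_n T n) (T (S n))) with (sum_n T n + T (S n))%C in A.
  generalize (Cmod_rev_triangle (T (S n)) (- (sum_n T n - l))%C).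
  rewrite Cmod_opp.
  replace (T (S n) - - (sum_n T n - l))%C with (sum_n T n + T (S n) - l)%C by ring.
  lra.
Qed.

Lemma cseries_norm_le T l b lb :
  cseries T l -> is_series b lb -> (forall n, Cmod (T n) <= b n) -> Cmod l <= lb.
Proof.
  intros H Hb HT.
  assert (L1 : is_lim_seq (fun n => Cmod (sum_n T n)) (Cmod l)).
  { exact (filterlim_comp _ _ _ _ _ _ _ _ H
      (@filterlim_norm C_AbsRing C_NormedModule l)). }
  assert (L2 : is_lim_seq (sum_n b) lb) by exact Hb.
  refine (is_lim_seq_le _ _ (Finite _) (Finite _) _ L1 L2). intros n.
  apply Rle_trans with (sum_n (fun n => Cmod (T n)) n).
  - exact (@norm_sum_n_m C_AbsRing C_NormedModule T 0 n).
  - apply sum_n_m_le. exact HT.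
Qed.

Definition cps (a : nat -> C) (w l : C) : Prop :=
  @is_pseries C_AbsRing C_NormedModule a w l.

Lemma cps_series a w l : cps a w l <-> cseries (fun n => w ^ n * a n)%C l.
Proof. reflexivity. Qed.

Lemma cps_radius a rad : 0 < rad ->
  (forall w, Cmod w < rad -> exists l, cps a w l) ->
  forall s, 0 <= s < rad -> Rbar_lt (Finite s) (CV_radius (fun n => Cmod (a n))).
Proof.
  intros Hr H s Hs. set (s' := (s + rad) / 2).
  apply Rbar_lt_le_trans with (Finite s'); [simpl; unfold s'; lra|].
  apply (proj1 (CV_radius_bounded (fun n => Cmod (a n)))).
  destruct (H (RtoC s')) as [l Hl].
  { rewrite Cmod_R, Rabs_pos_eq; unfold s'; lra. }
  destruct (cseries_terms_bounded _ _ (proj1 (cps_series _ _ _) Hl)) as [M HM].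
  exists M. intros n. specialize (HM n). rewrite Cmod_mult, Cmod_pow, Cmod_R in HM.
  rewrite Rabs_mult, <- RPow_abs, (Rabs_pos_eq (Cmod _)) by apply Cmod_ge_0. lra.
Qed.

Definition cps_derive (a : nat -> C) (n : nat) : C := (RtoC (INR (S n)) * a (S n))%C.

Lemma Cmod_cps_derive a n :
  Cmod (cps_derive a n) = PS_derive (fun n => Cmod (a n)) n.
Proof.
  unfold cps_derive, PS_derive. rewrite Cmod_mult, Cmod_R, Rabs_pos_eq; [reflexivity|].
  apply pos_INR.
Qed.

Lemma cps_derive_ex a rad w : 0 < rad ->
  (forall w, Cmod w < rad -> exists l, cps a w l) -> Cmod w < rad ->
  exists l, cps (cps_derive a) w l.
Proof.
  intros Hr H Hw.
  assert (X := cps_radius a rad Hr H (Cmod w) (conj (Cmod_ge_0 w) Hw)).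
  rewrite <- CV_radius_derive in X.
  assert (Y := CV_radius_inside (PS_derive (fun n => Cmod (a n))) (Cmod w)).
  rewrite Rabs_pos_eq in Y by apply Cmod_ge_0. specialize (Y X).
  apply ex_pseries_R in Y.
  refine (@ex_series_le C_AbsRing C_CompleteNormedModule
    (fun n => w ^ n * cps_derive a n)%C _ _ Y).
  intros n. change (Cmod (w ^ n * cps_derive a n)%C
    <= PS_derive (fun n => Cmod (a n)) n * Cmod w ^ n).
  rewrite Cmod_mult, Cmod_pow, Cmod_cps_derive. right. ring.
Qed.

Lemma Cmod_le_pow z s n : Cmod z <= s -> Cmod (z ^ n)%C <= s ^ n.
Proof. intros H. rewrite Cmod_pow. apply pow_incr. split; [apply Cmod_ge_0|exact H]. Qed.

(** The factor on the right is the second derivative of the monomial at [s], so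
    the remainders of a power series are summed by its twice differentiated
    majorant series. *)
Lemma pow_taylor w v s n : Cmod w <= s -> Cmod v <= s ->
  Cmod (w ^ S (S n) - v ^ S (S n) - RtoC (INR (S (S n))) * v ^ S n * (w - v))%C
  <= INR (S (S n)) * INR (S n) * s ^ n * Cmod (w - v)%C ^ 2.
Proof.
  intros Hw Hv.
  assert (Hs : 0 <= s) by (eapply Rle_trans; [apply Cmod_ge_0|exact Hw]).
  generalize (Cmod_ge_0 (w - v)%C). intros D0.
  induction n as [|n IH].
  - replace (w ^ 2 - v ^ 2 - RtoC (INR 2) * v ^ 1 * (w - v))%C with ((w - v) * (w - v))%C.
    + rewrite Cmod_mult. simpl. nra.
    + replace (INR 2) with (1 + 1) by (simpl; ring). rewrite RtoC_plus.
      rewrite !Cpow_S. simpl. ring.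
  - set (d := (w - v)%C) in *. set (k := S (S n)) in *.
    set (D := (w ^ k - v ^ k - RtoC (INR k) * v ^ S n * d)%C) in *.
    assert (E : (w ^ S k - v ^ S k - RtoC (INR (S k)) * v ^ k * d
       = w * D + RtoC (INR k) * v ^ S n * (d * d))%C).
    { unfold D, d, k. rewrite (S_INR (S (S n))), RtoC_plus.
      rewrite (Cpow_S w (S (S n))), (Cpow_S v (S (S n))), (Cpow_S v (S n)). ring. }
    rewrite E. eapply Rle_trans; [apply Cmod_triangle|].
    rewrite !Cmod_mult, Cmod_R.
    rewrite Rabs_pos_eq by apply pos_INR.
    assert (A : Cmod w * Cmod D <= s * (INR k * INR (S n) * s ^ n * Cmod d ^ 2)).
    { apply Rmult_le_compat; auto using Cmod_ge_0. }
    assert (B : Cmod (v ^ S n)%C <= s ^ S n) by now apply Cmod_le_pow.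
    assert (K0 : 0 <= INR k) by apply pos_INR.
    assert (B' : INR k * Cmod (v ^ S n)%C * (Cmod d * Cmod d)
             <= INR k * s ^ S n * (Cmod d * Cmod d)).
    { apply Rmult_le_compat_r; [nra|]. now apply Rmult_le_compat_l. }
    assert (Sn : 0 <= s ^ S n) by now apply pow_le.
    assert (N : INR (S k) = INR (S n) + 2) by (unfold k; rewrite !S_INR; ring).
    assert (P : 0 <= INR k * s ^ S n * (Cmod d * Cmod d)).
    { apply Rmult_le_pos; [now apply Rmult_le_pos|now apply Rmult_le_pos]. }
    assert (T : INR k * s ^ S n * (Cmod d * Cmod d) = INR k * (s ^ n * s) * Cmod d ^ 2)
      by (simpl; ring).
    rewrite T in B', P.
    replace (INR (S k) * INR k * s ^ S n * Cmod d ^ 2) with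
      (s * (INR k * INR (S n) * s ^ n * Cmod d ^ 2)
       + 2 * (INR k * (s ^ n * s) * Cmod d ^ 2)) by (rewrite N; simpl; ring).
    lra.
Qed.

Lemma cseries_shift T l :
  cseries T l -> cseries (fun n => T (S n)) (l - T 0%nat)%C.
Proof.
  intros H. apply (@is_series_incr_1 C_AbsRing C_NormedModule T).
  change (cseries T (l - T 0%nat + T 0%nat)%C).
  now replace (l - T 0%nat + T 0%nat)%C with l by ring.
Qed.

Lemma cseries_ext T U l : (forall n, T n = U n) -> cseries T l -> cseries U l.
Proof. intros E. apply (is_series_ext _ _ _ E). Qed.

Lemma cseries_minus T U l m :
  cseries T l -> cseries U m -> cseries (fun n => T n - U n)%C (l - m)%C.
Proof. exact (@is_series_minus C_AbsRing C_NormedModule T U l m). Qed.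

Lemma cseries_scal c T l : cseries T l -> cseries (fun n => c * T n)%C (c * l)%C.
Proof. exact (@is_series_scal C_AbsRing C_NormedModule c T l). Qed.

(** Termwise differentiation, with an error that is uniform on smaller disks:
    the uniformity is used for the convergence of difference quotients. *)
Lemma cps_taylor a F rad s : 0 <= s < rad ->
  (forall w, Cmod w < rad -> cps a w (F w)) ->
  exists B, forall w v l, Cmod w <= s -> Cmod v <= s -> cps (cps_derive a) v l ->
    Cmod (F w - F v - l * (w - v))%C <= B * Cmod (w - v)%C ^ 2.
Proof.
  intros Hs HF.
  set (b := fun n => Cmod (a n)).
  assert (X := cps_radius a rad ltac:(lra) (fun w Hw => ex_intro _ _ (HF w Hw)) s Hs).
  rewrite <- CV_radius_derive, <- CV_radius_derive in X.
  assert (Y := CV_radius_inside (PS_derive (PS_derive b)) s).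
  rewrite Rabs_pos_eq in Y by lra. specialize (Y X). apply ex_pseries_R in Y.
  destruct Y as [B HB]. exists B. intros w v l Hw Hv Hl.
  assert (S1 := cseries_shift _ _ (cseries_shift _ _
    (cseries_minus _ _ _ _ (proj1 (cps_series _ _ _) (HF w ltac:(lra)))
       (proj1 (cps_series _ _ _) (HF v ltac:(lra)))))).
  assert (S2 := cseries_scal (w - v)%C _ _ (cseries_shift _ _ (proj1 (cps_series _ _ _) Hl))).
  assert (S3 := cseries_minus _ _ _ _ S1 S2).
  apply (cseries_norm_le _ _ (fun n => PS_derive (PS_derive b) n * s ^ n * Cmod (w - v)%C ^ 2)
        (B * Cmod (w - v)%C ^ 2)) in S3.
  - match type of S3 with Cmod ?x <= _ => replace (F w - F v - l * (w - v))%C with x end.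
    + exact S3.
    + unfold cps_derive. simpl Cpow. simpl INR. ring.
  - exact (is_series_scal_r (Cmod (w - v)%C ^ 2) _ _ HB).
  - intros n. unfold cps_derive.
    match goal with |- Cmod ?x <= _ => replace x with
      ((w ^ S (S n) - v ^ S (S n) - RtoC (INR (S (S n))) * v ^ S n * (w - v))
         * a (S (S n)))%C by ring end.
    rewrite Cmod_mult. unfold PS_derive. fold (b (S (S n))).
    replace (INR (S n) * (INR (S (S n)) * b (S (S n))) * s ^ n * Cmod (w - v)%C ^ 2)
      with (INR (S (S n)) * INR (S n) * s ^ n * Cmod (w - v)%C ^ 2 * b (S (S n))) by ring.
    apply Rmult_le_compat_r; [apply Cmod_ge_0|]. now apply pow_taylor.
Qed.

Lemma cderiv_of_taylor F v l d B : 0 < d ->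
  (forall w, Cmod (w - v)%C < d -> Cmod (F w - F v - l * (w - v))%C <= B * Cmod (w - v)%C ^ 2) ->
  cderiv F v l.
Proof.
  intros Hd H.
  exists (fun w => if Ceq_dec w v then l else ((F w - F v) / (w - v))%C).
  split; [|split].
  - intros w. destruct (Ceq_dec w v) as [->|N]; [ring|].
    field. now apply Cminus_eq_contra.
  - destruct (Ceq_dec v v); congruence.
  - intros eps He. set (B' := Rabs B + 1).
    assert (HB : 0 < B') by (unfold B'; generalize (Rabs_pos B); lra).
    assert (HB1 : B <= B') by (unfold B'; generalize (Rle_abs B); lra).
    exists (Rmin d (eps / B')). split.
    { apply Rmin_pos; [exact Hd|]. now apply Rdiv_lt_0_compat. }
    intros w Hw. assert (W1 := Rlt_le_trans _ _ _ Hw (Rmin_l _ _)).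
    assert (W2 := Rlt_le_trans _ _ _ Hw (Rmin_r _ _)).
    destruct (Ceq_dec v v) as [_|]; [|congruence].
    destruct (Ceq_dec w v) as [->|N]; [rewrite Cmod_minus_diag; exact He|].
    assert (N' : (w - v)%C <> RtoC 0) by now apply Cminus_eq_contra.
    replace ((F w - F v) / (w - v) - l)%C with ((F w - F v - l * (w - v)) / (w - v))%C
      by (field; exact N').
    assert (P : 0 < Cmod (w - v)%C) by now apply Cmod_gt_0.
    rewrite Cmod_div by exact N'. apply (Rlt_div_l _ _ _ P).
    eapply Rle_lt_trans; [now apply H|].
    apply (Rlt_div_r _ _ _ HB) in W2. simpl. nra.
Qed.

Lemma analytic_at_taylor f z : analytic_at f z ->
  exists rho B, 0 < rho /\ forall w v, Cmod (w - z)%C < rho -> Cmod (v - z)%C < rho ->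
    cderiv f v (C_derive f v) /\
    Cmod (f w - f v - C_derive f v * (w - v))%C <= B * Cmod (w - v)%C ^ 2.
Proof.
  intros [a [r [Hr H]]].
  assert (H' : forall u, Cmod u < r -> cps a u (f (z + u)%C)).
  { intros u Hu. assert (X := H (z + u)%C).
    replace (z + u - z)%C with u in X by ring. now apply X. }
  destruct (cps_taylor a (fun u => f (z + u)%C) r (r / 2) ltac:(lra) H') as [B HB].
  assert (Q : forall v l, Cmod (v - z)%C < r / 2 -> cps (cps_derive a) (v - z)%C l ->
     forall w, Cmod (w - z)%C < r / 2 ->
     Cmod (f w - f v - l * (w - v))%C <= B * Cmod (w - v)%C ^ 2).
  { intros v l Hv Hl w Hw.
    assert (X := HB (w - z)%C (v - z)%C l (Rlt_le _ _ Hw) (Rlt_le _ _ Hv) Hl).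
    cbv beta in X.
    replace (z + (w - z))%C with w in X by ring.
    replace (z + (v - z))%C with v in X by ring.
    now replace (w - z - (v - z))%C with (w - v)%C in X by ring. }
  exists (r / 2), B. split; [lra|]. intros w v Hw Hv.
  destruct (cps_derive_ex a r (v - z)%C Hr (fun w Hw => ex_intro _ _ (H' w Hw)) ltac:(lra))
    as [l Hl].
  assert (D : cderiv f v l).
  { apply (cderiv_of_taylor f v l (r / 2 - Cmod (v - z)%C) B); [lra|].
    intros x Hx. apply Q; auto.
    generalize (Cmod_sub_triangle x v z). lra. }
  rewrite (cderiv_C_derive _ _ _ D). split; [exact D|]. now apply Q.
Qed.

Lemma analytic_at_derive f z : analytic_at f z -> analytic_at (C_derive f) z.
Proof.
  intros [a [r [Hr H]]].
  assert (H' : forall u, Cmod u < r -> cps a u (f (z + u)%C)).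
  { intros u Hu. assert (X := H (z + u)%C).
    replace (z + u - z)%C with u in X by ring. now apply X. }
  exists (cps_derive a), r. split; [exact Hr|].
  intros v Hv.
  destruct (cps_derive_ex a r (v - z)%C Hr (fun w Hw => ex_intro _ _ (H' w Hw)) Hv)
    as [l Hl].
  replace (C_derive f v) with l; [exact Hl|]. symmetry. apply cderiv_C_derive.
  set (s := (Cmod (v - z)%C + r) / 2).
  assert (S0 := Cmod_ge_0 (v - z)%C).
  destruct (cps_taylor a (fun u => f (z + u)%C) r s ltac:(unfold s; lra) H') as [B HB].
  apply (cderiv_of_taylor f v l (s - Cmod (v - z)%C) B); [unfold s; lra|].
  intros w Hw.
  assert (W : Cmod (w - z)%C <= s) by (generalize (Cmod_sub_triangle w v z); lra).
  assert (X := HB (w - z)%C (v - z)%C l W ltac:(unfold s; lra) Hl). cbv beta in X.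
  replace (z + (w - z))%C with w in X by ring.
  replace (z + (v - z))%C with v in X by ring.
  now replace (w - z - (v - z))%C with (w - v)%C in X by ring.
Qed.

Lemma analytic_at_holo f z : analytic_at f z -> holo_at f z.
Proof.
  intros H. destruct (analytic_at_taylor f z H) as [r1 [B1 [Hr1 H1]]].
  destruct (analytic_at_taylor _ z (analytic_at_derive f z H)) as [r2 [B2 [Hr2 H2]]].
  exists (C_derive f), (Rmin r1 r2). split; [now apply Rmin_pos|].
  intros w Hw. split.
  - apply (H1 w w); (eapply Rlt_le_trans; [exact Hw|apply Rmin_l]).
  - eapply cderiv_ccont. apply (H2 w w); (eapply Rlt_le_trans; [exact Hw|apply Rmin_r]).
Qed.

Lemma cseries_unique T l m : cseries T l -> cseries T m -> l = m.
Proof.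
  intros Hl Hm. apply NNPP. intros N.
  assert (X : Cmod (l - m)%C <= 0).
  { apply (cseries_norm_le _ _ (fun _ => 0) 0 (cseries_minus _ _ _ _ Hl Hm)).
    - apply filterlim_ext with (fun _ : nat => 0); [|apply filterlim_const].
      intros n. symmetry. rewrite sum_n_const. apply Rmult_0_r.
    - intros n. rewrite Cmod_minus_diag. lra. }
  assert (0 < Cmod (l - m)%C) by (apply Cmod_gt_0; now apply Cminus_eq_contra). lra.
Qed.

Lemma cps_at_0 a l : cps a (RtoC 0) l -> l = a 0%nat.
Proof.
  intros H. exact (cseries_unique _ _ _ H (@is_pseries_0 C_AbsRing C_NormedModule a)).
Qed.

Definition extended_quotient (F : C -> C) (z0 c w : C) : C :=
  if Ceq_dec w z0 then c else (F w / (w - z0))%C.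

Lemma cps_extended_quotient a F z0 rad :
  (forall u, Cmod u < rad -> cps a u (F (z0 + u)%C)) -> a 0%nat = RtoC 0 ->
  forall u, Cmod u < rad -> cps (fun n => a (S n)) u (extended_quotient F z0 (a 1%nat) (z0 + u)%C).
Proof.
  intros H H0 u Hu. unfold extended_quotient. destruct (Ceq_dec (z0 + u)%C z0) as [E|N].
  - assert (U : u = RtoC 0).
    { replace u with ((z0 + u) - z0)%C by ring. rewrite E. ring. }
    subst u. exact (@is_pseries_0 C_AbsRing C_NormedModule (fun n => a (S n))).
  - assert (U : u <> RtoC 0) by (intros ->; apply N; ring).
    assert (X := @is_pseries_decr_1 C_AbsRing C_NormedModule a u (/ u)%C (F (z0 + u)%C)
      (Cinv_l u U) (H u Hu)).
    change (cps (fun n => a (S n)) u (/ u * (F (z0 + u) + - a 0%nat))%C) in X.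
    replace (F (z0 + u) / (z0 + u - z0))%C with (/ u * (F (z0 + u) + - a 0%nat))%C;
    [exact X|].
    rewrite H0. replace (z0 + u - z0)%C with u by ring. field. exact U.
Qed.

Lemma analytic_at_cps F z0 : analytic_at F z0 <->
  exists a rad, 0 < rad /\ forall u, Cmod u < rad -> cps a u (F (z0 + u)%C).
Proof.
  split; intros [a [r [Hr H]]]; exists a, r; (split; [exact Hr|]).
  - intros u Hu. assert (X := H (z0 + u)%C).
    replace (z0 + u - z0)%C with u in X by ring. now apply X.
  - intros w Hw. assert (X := H (w - z0)%C Hw).
    now replace (z0 + (w - z0))%C with w in X by ring.
Qed.

Lemma analytic_at_extended_quotient F z0 : analytic_at F z0 -> F z0 = RtoC 0 ->
  analytic_at (extended_quotient F z0 (C_derive F z0)) z0.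
Proof.
  intros H H0. apply analytic_at_cps in H. destruct H as [a [r [Hr H]]].
  assert (A0 : a 0%nat = RtoC 0).
  { symmetry. rewrite <- H0. apply cps_at_0.
    assert (X := H (RtoC 0)). rewrite Cmod_0, Cplus_0_r in X. now apply X. }
  assert (A : analytic_at (extended_quotient F z0 (a 1%nat)) z0).
  { apply analytic_at_cps. exists (fun n => a (S n)), r. split; [exact Hr|].
    now apply cps_extended_quotient. }
  assert (D : cderiv F z0 (a 1%nat)).
  { exists (extended_quotient F z0 (a 1%nat)). split; [|split].
    - intros w. unfold extended_quotient. destruct (Ceq_dec w z0) as [->|N]; [ring|].
      rewrite H0. field. now apply Cminus_eq_contra.
    - unfold extended_quotient. destruct (Ceq_dec z0 z0); congruence.
    - now apply holo_at_ccont, analytic_at_holo. }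
  now rewrite (cderiv_C_derive _ _ _ D).
Qed.

(** * Isolated zeros and the derivative of a univalent function *)

Lemma cps_zeros_isolated k : forall a F z0 rad, 0 < rad ->
  (forall u, Cmod u < rad -> cps a u (F (z0 + u)%C)) -> a k <> RtoC 0 ->
  exists d, 0 < d /\ forall w, w <> z0 -> Cmod (w - z0)%C < d -> F w <> RtoC 0.
Proof.
  induction k as [|k IH]; intros a F z0 r Hr H Hk.
  - assert (E : F z0 = a 0%nat).
    { apply cps_at_0. assert (X := H (RtoC 0)). rewrite Cmod_0, Cplus_0_r in X. now apply X. }
    destruct (ccont_neq0 F z0) as [d [Hd Hn]].
    + apply holo_at_ccont, analytic_at_holo, analytic_at_cps. eauto.
    + congruence.
    + exists d. split; auto.
  - destruct (Ceq_dec (a 0%nat) (RtoC 0)) as [Z|NZ].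
    + destruct (IH (fun n => a (S n)) (extended_quotient F z0 (a 1%nat)) z0 r Hr
        (cps_extended_quotient a F z0 r H Z) Hk) as [d [Hd Hn]].
      exists d. split; [exact Hd|]. intros w Nw Hw E. apply (Hn w Nw Hw).
      unfold extended_quotient. destruct (Ceq_dec w z0); [contradiction|]. rewrite E.
      unfold Cdiv. ring.
    + assert (E : F z0 = a 0%nat).
      { apply cps_at_0. assert (X := H (RtoC 0)).
        rewrite Cmod_0, Cplus_0_r in X. now apply X. }
      destruct (ccont_neq0 F z0) as [d [Hd Hn]].
      * apply holo_at_ccont, analytic_at_holo, analytic_at_cps. eauto.
      * congruence.
      * exists d. split; auto.
Qed.

Lemma analytic_zeros F z0 : analytic_at F z0 ->
  exists d, 0 < d /\
   ((forall w, Cmod (w - z0)%C < d -> F w = RtoC 0) \/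
    (forall w, w <> z0 -> Cmod (w - z0)%C < d -> F w <> RtoC 0)).
Proof.
  intros H. apply analytic_at_cps in H. destruct H as [a [r [Hr H]]].
  destruct (classic (exists k, a k <> RtoC 0)) as [[k Hk]|N].
  - destruct (cps_zeros_isolated k a F z0 r Hr H Hk) as [d [Hd Hn]].
    exists d. auto.
  - exists r. split; [exact Hr|]. left. intros w Hw.
    assert (X := H (w - z0)%C Hw).
    replace (z0 + (w - z0))%C with w in X by ring.
    assert (Z := cseries_scal (RtoC 0) _ _ (proj1 (cps_series _ _ _) X)).
    rewrite Cmult_0_l in Z.
    apply (cseries_unique (fun n => (w - z0) ^ n * a n)%C _ _ X).
    apply cseries_ext with (2 := Z).
    intros n. destruct (Ceq_dec (a n) (RtoC 0)) as [E|E]; [rewrite E; ring|].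
    exfalso. apply N. eauto.
Qed.

Lemma pderiv_snd g s l : pderiv g s l -> is_derive (fun x => snd (g x)) s (snd l).
Proof.
  intros H.
  assert (X : pderiv (fun x => - Ci * g x)%C s (- Ci * l)%C).
  { apply (pderiv_comp (fun z => - Ci * z)%C g); [apply cderiv_scal|exact H]. }
  apply pderiv_fst in X.
  replace (snd l) with (fst (- Ci * l)%C) by (simpl; ring).
  apply is_derive_ext with (2 := X). intros t. simpl. ring.
Qed.

Lemma constant_of_derive_0 F a rad :
  (forall w, Cmod (w - a)%C < rad -> cderiv F w (RtoC 0)) ->
  forall w, Cmod (w - a)%C < rad -> F w = F a.
Proof.
  intros H w Hw.
  set (g := fun s : R => (a + RtoC s * (w - a))%C).
  assert (D : forall s, 0 <= s <= 1 -> pderiv (fun s => F (g s)) s (RtoC 0)).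
  { intros s Hs. replace (RtoC 0) with (RtoC 0 * (w - a))%C by ring.
    apply pderiv_comp; [|apply pderiv_line].
    apply H. unfold g. replace (a + RtoC s * (w - a) - a)%C with (RtoC s * (w - a))%C by ring.
    rewrite Cmod_mult, Cmod_R, Rabs_pos_eq by lra.
    generalize (Cmod_ge_0 (w - a)%C). nra. }
  assert (E1 : fst (F (g 0)) = fst (F (g 1))).
  { apply (eq_is_derive (fun s => fst (F (g s)))); [|lra].
    intros s Hs. exact (pderiv_fst _ _ _ (D s Hs)). }
  assert (E2 : snd (F (g 0)) = snd (F (g 1))).
  { apply (eq_is_derive (fun s => snd (F (g s)))); [|lra].
    intros s Hs. exact (pderiv_snd _ _ _ (D s Hs)). }
  assert (G0 : g 0 = a) by (unfold g; ring).
  assert (G1 : g 1 = w) by (unfold g; ring).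
  rewrite G0, G1 in E1, E2. symmetry. now apply injective_projections.
Qed.

(** The difference quotients with a fixed increment do not vanish and converge
    uniformly near [a] to the derivative.  If [a] were an isolated zero of the
    derivative, they would be bounded below on a small circle about [a] but tend
    to 0 at [a], against the minimum principle. *)
Lemma univalent_derive_neq0 f a :
  analytic_on_disk f -> univalent_on_disk f -> in_disk a -> C_derive f a <> RtoC 0.
Proof.
  intros Hf Uf Ha H0. unfold in_disk in Ha.
  destruct (analytic_at_taylor f a (Hf a Ha)) as [r1 [B [Hr1 HT]]].
  destruct (analytic_zeros _ _ (analytic_at_derive f a (Hf a Ha))) as [r2 [Hr2 HZ]].
  set (r := Rmin (Rmin r1 r2) (1 - Cmod a)).
  assert (r0 : 0 < r) by (repeat apply Rmin_pos; lra).
  assert (R1 : r <= r1) by (eapply Rle_trans; [apply Rmin_l|apply Rmin_l]).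
  assert (R2 : r <= r2) by (eapply Rle_trans; [apply Rmin_l|apply Rmin_r]).
  assert (R3 : r <= 1 - Cmod a) by apply Rmin_r.
  assert (In : forall w, Cmod (w - a)%C < r -> in_disk w).
  { intros w Hw. unfold in_disk. generalize (Cmod_rev_triangle w a). lra. }
  destruct HZ as [HZ|HZ].
  - (* a locally constant function is not injective *)
    assert (K : forall w, Cmod (w - a)%C < r -> f w = f a).
    { apply constant_of_derive_0. intros w Hw.
      assert (X := proj1 (HT w w ltac:(lra) ltac:(lra))).
      now rewrite HZ in X by lra. }
    assert (D : Cmod (a + RtoC (r / 2) - a)%C = r / 2).
    { replace (a + RtoC (r / 2) - a)%C with (RtoC (r / 2)) by ring.
      rewrite Cmod_R. apply Rabs_pos_eq. lra. }
    assert (E : (a + RtoC (r / 2))%C = a).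
    { apply Uf; [apply In; lra|exact Ha|]. apply K. lra. }
    rewrite E, Cmod_minus_diag in D. lra.
  - set (tau' := r / 2). set (tau := r / 4).
    assert (Ht : 0 < tau < tau') by (unfold tau, tau'; lra).
    assert (Ic : forall t, Cmod (a + RtoC tau * Cexp_i t - a)%C < r).
    { intros t. rewrite Cmod_circle by lra. unfold tau. lra. }
    destruct (circle_min (fun t => Cmod (C_derive f (a + RtoC tau * Cexp_i t)%C)))
      as [m [Hm Hmin]].
    { intros t. apply (tcont_Cmod (fun t => C_derive f (a + RtoC tau * Cexp_i t)%C)).
      apply (tcont_on_circle (C_derive f) a tau). intros s.
      apply holo_at_ccont, analytic_at_holo, analytic_at_derive, Hf, In, Ic. }
    { intros t. apply Cmod_gt_0. apply HZ; [|eapply Rlt_le_trans; [apply Ic|exact R2]].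
      intros E. assert (X := Cmod_circle a tau t ltac:(lra)).
      rewrite E, Cmod_minus_diag in X. lra. }
    set (B' := Rabs B + 1).
    assert (HB : 0 < B') by (unfold B'; generalize (Rabs_pos B); lra).
    assert (HB1 : B <= B') by (unfold B'; generalize (Rle_abs B); lra).
    set (h := Rmin (r / 4) (m / 4 / B')).
    assert (h0 : 0 < h) by (apply Rmin_pos; [lra|]; apply Rdiv_lt_0_compat; lra).
    assert (h1 : h <= r / 4) by apply Rmin_l.
    assert (h2 : h <= m / 4 / B') by apply Rmin_r.
    apply (Rle_div_r _ _ _ HB) in h2.
    assert (Nh : RtoC h <> RtoC 0) by (apply RtoC_neq0; lra).
    set (Q := fun w => ((f (w + RtoC h) - f w) / RtoC h)%C).
    assert (Sh : forall w, Cmod (w - a)%C < tau' -> Cmod (w + RtoC h - a)%C < r).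
    { intros w Hw. replace (w + RtoC h - a)%C with ((w - a) + RtoC h)%C by ring.
      eapply Rle_lt_trans; [apply Cmod_triangle|].
      rewrite Cmod_R, Rabs_pos_eq by lra. unfold tau' in Hw. lra. }
    assert (QD : forall w, Cmod (w - a)%C < tau' -> Cmod (Q w - C_derive f w)%C <= m / 4).
    { intros w Hw.
      assert (X := proj2 (HT (w + RtoC h)%C w
        (Rlt_le_trans _ _ _ (Sh w Hw) R1) ltac:(unfold tau' in Hw; lra))).
      replace (w + RtoC h - w)%C with (RtoC h) in X by ring.
      unfold Q.
      replace ((f (w + RtoC h) - f w) / RtoC h - C_derive f w)%C with
        ((f (w + RtoC h) - f w - C_derive f w * RtoC h) / RtoC h)%C by (field; exact Nh).
      rewrite Cmod_div_RtoC by lra.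
      rewrite Cmod_R, Rabs_pos_eq in X by lra.
      apply Rle_trans with (B * h ^ 2 / h).
      - apply Rmult_le_compat_r; [left; now apply Rinv_0_lt_compat|exact X].
      - replace (B * h ^ 2 / h) with (B * h) by (field; lra). nra. }
    assert (M : m / 2 <= Cmod (Q a)).
    { apply (minimum_principle Q a tau tau'); [exact Ht| |lra|].
      - intros w Hw. split.
        + apply holo_at_div; [|apply holo_at_const|exact Nh].
          apply holo_at_minus.
          * apply (holo_at_comp f (fun w => w + RtoC h)%C).
            -- now apply analytic_at_holo, Hf, In, Sh.
            -- apply holo_at_plus; [apply holo_at_id|apply holo_at_const].
          * apply analytic_at_holo, Hf, In. unfold tau' in Hw. lra.
        + intros E.
          assert (E' : f (w + RtoC h)%C = f w).
          { apply Ceq_minus. replace (f (w + RtoC h) - f w)%C with (Q w * RtoC h)%C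
              by (unfold Q; field; exact Nh). rewrite E. ring. }
          apply Uf in E'.
          * apply Nh. replace (RtoC h) with ((w + RtoC h) - w)%C by ring. rewrite E'. ring.
          * apply In, Sh, Hw.
          * apply In. unfold tau' in Hw. lra.
      - intros t Htt. specialize (Hmin t Htt).
        assert (X := QD (a + RtoC tau * Cexp_i t)%C).
        rewrite Cmod_circle in X by lra. specialize (X (proj2 Ht)).
        generalize (Cmod_rev_triangle (C_derive f (a + RtoC tau * Cexp_i t)%C)
          (Q (a + RtoC tau * Cexp_i t)%C)).
        rewrite Cmod_minus_sym. lra. }
    assert (X := QD a). rewrite Cmod_minus_diag, H0 in X.
    replace (Q a - RtoC 0)%C with (Q a) in X by ring.
    specialize (X ltac:(lra)). lra.
Qed.

(** * Starlike mappings *)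

Lemma analytic_holo_disk f : analytic_on_disk f -> holo_disk f.
Proof. intros H z Hz. now apply analytic_at_holo, H. Qed.

Lemma in_disk_0 : in_disk (RtoC 0).
Proof. unfold in_disk. rewrite Cmod_0. lra. Qed.

Lemma in_disk_near z w : in_disk z -> Cmod (w - z)%C < 1 - Cmod z -> in_disk w.
Proof. unfold in_disk. intros Hz Hw. generalize (Cmod_rev_triangle w z). lra. Qed.

(** A map [W] with [f (W z) = t f z] inherits differentiability from [f], which
    has a continuous inverse and a nonvanishing derivative. *)
Lemma lift_holo f W t : analytic_on_disk f -> univalent_on_disk f -> 0 < t < 1 ->
  (forall z, in_disk z -> in_disk (W z) /\ f (W z) = (RtoC t * f z)%C) ->
  holo_disk W.
Proof.
  intros Hf Uf Ht HW.
  assert (Cf := analytic_holo_disk f Hf).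
  assert (D : forall z, in_disk z ->
    cderiv W z (RtoC t * C_derive f z / C_derive f (W z))%C).
  { intros z Hz. destruct (HW z Hz) as [Wz Ez].
    assert (Hz1 : 0 < 1 - Cmod z) by (unfold in_disk in Hz; lra).
    assert (N := univalent_derive_neq0 f (W z) Hf Uf Wz).
    assert (CW : ccont W z).
    { intros eps He.
      destruct (inverse_continuous f (W z) Cf Uf Wz eps He) as [d [Hd H]].
      destruct (holo_at_ccont f z (Cf z Hz) d Hd) as [d' [Hd' H']].
      exists (Rmin d' (1 - Cmod z)). split; [now apply Rmin_pos|]. intros w Hw.
      assert (W1 := Rlt_le_trans _ _ _ Hw (Rmin_l _ _)).
      assert (W2 := Rlt_le_trans _ _ _ Hw (Rmin_r _ _)).
      destruct (HW w (in_disk_near z w Hz W2)) as [Ww Ew].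
      apply H; [exact Ww|]. rewrite Ew, Ez.
      replace (RtoC t * f w - RtoC t * f z)%C with (RtoC t * (f w - f z))%C by ring.
      rewrite Cmod_mult, Cmod_R, Rabs_pos_eq by lra.
      specialize (H' w W1). generalize (Cmod_ge_0 (f w - f z)%C). nra. }
    destruct (holo_at_derive f z (Cf z Hz)) as [[p [Ep [Hp Cp]]] _].
    destruct (holo_at_derive f (W z) (Cf _ Wz)) as [[q [Eq [Hq Cq]]] _].
    assert (CqW : ccont (fun w => q (W w)) z) by now apply ccont_comp.
    destruct (ccont_neq0 (fun w => q (W w)) z CqW) as [d [Hd Hn]]; [now rewrite Hq|].
    assert (Key : forall w, Cmod (w - z)%C < Rmin d (1 - Cmod z) ->
       (W w - W z = RtoC t * p w / q (W w) * (w - z))%C).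
    { intros w Hw.
      assert (W1 := Rlt_le_trans _ _ _ Hw (Rmin_l _ _)).
      assert (W2 := Rlt_le_trans _ _ _ Hw (Rmin_r _ _)).
      destruct (HW w (in_disk_near z w Hz W2)) as [Ww Ew].
      specialize (Hn w W1).
      assert (X := Eq (W w)). rewrite Ew, Ez in X.
      replace (RtoC t * f w - RtoC t * f z)%C with (RtoC t * (f w - f z))%C in X by ring.
      rewrite Ep in X.
      transitivity (q (W w) * (W w - W z) / q (W w))%C; [field; exact Hn|].
      rewrite <- X. field. exact Hn. }
    exists (fun w => if Ceq_dec w z then (RtoC t * C_derive f z / C_derive f (W z))%C
                else ((W w - W z) / (w - z))%C).
    split; [|split].
    - intros w. destruct (Ceq_dec w z) as [->|Nw]; [ring|].
      field. now apply Cminus_eq_contra.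
    - destruct (Ceq_dec z z); congruence.
    - apply ccont_ext_loc with (fun w => RtoC t * p w * / q (W w))%C (Rmin d (1 - Cmod z)).
      + now apply Rmin_pos.
      + intros w Hw. destruct (Ceq_dec w z) as [->|Nw]; [now rewrite Hp, Hq|].
        rewrite Key by exact Hw. field. split.
        * apply Hn. eapply Rlt_le_trans; [exact Hw|apply Rmin_l].
        * now apply Cminus_eq_contra.
      + apply ccont_mult.
        * apply ccont_mult; [apply ccont_const|exact Cp].
        * apply ccont_inv; [now rewrite Hq|exact CqW]. }
  intros z Hz.
  exists (fun w => RtoC t * C_derive f w / C_derive f (W w))%C, (1 - Cmod z).
  split; [unfold in_disk in Hz; lra|]. intros w Hw.
  assert (Hw' := in_disk_near z w Hz Hw). split; [now apply D|].
  destruct (HW w Hw') as [Ww _].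
  assert (Cd : forall v, in_disk v -> ccont (C_derive f) v).
  { intros v Hv. now apply holo_at_derive, Cf. }
  apply ccont_mult.
  - apply ccont_mult; [apply ccont_const|now apply Cd].
  - apply ccont_inv; [now apply univalent_derive_neq0|].
    apply ccont_comp; [now apply Cd|]. eapply cderiv_ccont. now apply D.
Qed.

(** Schwarz's lemma for the self-map [z -> f^{-1} (t f z)] of the disk. *)
Lemma starlike_contraction f t z y : normalized_starlike f -> 0 < t < 1 ->
  in_disk z -> in_disk y -> f y = (RtoC t * f z)%C -> Cmod y <= Cmod z.
Proof.
  intros [Hf [Uf [f0 [_ Sf]]]] Ht Hz Hy E.
  set (P := fun z y => in_disk y /\ f y = (RtoC t * f z)%C).
  set (W := fun z => epsilon (inhabits (RtoC 0)) (P z)).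
  assert (HW : forall z, in_disk z -> in_disk (W z) /\ f (W z) = (RtoC t * f z)%C).
  { intros x Hx. unfold W. apply (epsilon_spec (inhabits (RtoC 0)) (P x)).
    destruct (Sf (f x) t) as [v [Hv Ev]]; [exists x; auto|lra|]. exists v. split; auto. }
  assert (U : forall x v, in_disk x -> in_disk v -> f v = (RtoC t * f x)%C -> W x = v).
  { intros x v Hx Hv Ev. destruct (HW x Hx) as [A B]. apply Uf; auto. congruence. }
  rewrite <- (U z y Hz Hy E). apply schwarz; [|apply U| |exact Hz]; auto using in_disk_0.
  - now apply lift_holo with f t.
  - rewrite f0. ring.
  - intros x Hx. left. now apply HW.
Qed.

(** Letting [t] increase to 1, the displacement of [z] towards
    [f^{-1} (t f z)] is proportional to [- f z / f' z] in the limit, and it never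
    points out of the circle through [z]. *)
Lemma starlike_Re_nonneg f z : normalized_starlike f -> in_disk z ->
  0 <= fst (Cconj z * f z * Cconj (C_derive f z))%C.
Proof.
  intros Sf0 Hz. destruct (Sf0) as [Hf [Uf [f0 [f1 Sf']]]].
  assert (Cf := analytic_holo_disk f Hf).
  apply Rnot_lt_le. intros Neg.
  set (n := fst (Cconj z * f z * Cconj (C_derive f z))%C) in *.
  set (A := Cmod z * Cmod (f z) + 1).
  assert (HA : 0 < A).
  { unfold A. generalize (Rmult_le_pos _ _ (Cmod_ge_0 z) (Cmod_ge_0 (f z))). lra. }
  destruct (holo_at_derive f z (Cf z Hz)) as [[q [Eq [Hq Cq]]] _].
  destruct (Cq (- n / A)) as [d1 [Hd1 H1]]; [apply Rdiv_lt_0_compat; lra|].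
  destruct (inverse_continuous f z Cf Uf Hz d1 Hd1) as [d2 [Hd2 H2]].
  set (t := 1 - Rmin (1 / 2) (d2 / (Cmod (f z) + 1))).
  generalize (Cmod_ge_0 (f z)). intros F0.
  assert (e0 : 0 < Rmin (1 / 2) (d2 / (Cmod (f z) + 1))).
  { apply Rmin_pos; [lra|]. apply Rdiv_lt_0_compat; lra. }
  assert (e1 : Rmin (1 / 2) (d2 / (Cmod (f z) + 1)) <= 1 / 2) by apply Rmin_l.
  assert (e2 : Rmin (1 / 2) (d2 / (Cmod (f z) + 1)) <= d2 / (Cmod (f z) + 1))
    by apply Rmin_r.
  assert (Ht : 0 < t < 1) by (unfold t; lra).
  assert (e3 : (1 - t) * (Cmod (f z) + 1) <= d2).
  { apply Rle_div_r in e2; [|lra]. unfold t. lra. }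
  destruct (Sf' (f z) t) as [y [Hy Ey]]; [exists z; auto|lra|].
  assert (L := starlike_contraction f t z y Sf0 Ht Hz Hy Ey).
  assert (Dy : Cmod (y - z)%C < d1).
  { apply H2; [exact Hy|]. rewrite Ey.
    replace (RtoC t * f z - f z)%C with (RtoC (- (1 - t)) * f z)%C
      by (rewrite RtoC_opp, RtoC_minus; ring).
    rewrite Cmod_mult, Cmod_R, Rabs_Ropp, Rabs_pos_eq by lra. lra. }
  specialize (H1 y Dy). rewrite Hq in H1.
  assert (X := Eq y). rewrite Ey in X.
  (* [Cmod y <= Cmod z] bounds the radial component of [y - z]. *)
  assert (R0 : fst (Cconj z * (y - z))%C <= 0).
  { assert (L2 : Cmod y ^ 2 <= Cmod z ^ 2)
      by (apply pow_incr; split; [apply Cmod_ge_0|exact L]).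
    rewrite !Cmod2_alt in L2. destruct z as [z1 z2]. destruct y as [y1 y2].
    simpl in L2 |- *.
    generalize (Rle_0_sqr (y1 - z1)) (Rle_0_sqr (y2 - z2)). unfold Rsqr. lra. }
  assert (R1 : 0 <= fst (Cconj z * f z * Cconj (q y))%C).
  { assert (Y : (RtoC (1 - t) * (Cconj z * f z * Cconj (q y)))%C =
       (RtoC (- Cmod (q y) ^ 2) * (Cconj z * (y - z)))%C).
    { transitivity (- (1) * (Cconj z * (RtoC t * f z - f z) * Cconj (q y)))%C;
      [rewrite RtoC_minus; ring|].
      rewrite X, RtoC_opp, Cmod2_conj. ring. }
    apply (f_equal fst) in Y. rewrite (re_scal_l (1 - t)), (re_scal_l (- _)) in Y.
    change (Re (Cconj z * f z * Cconj (q y))%C) with (fst (Cconj z * f z * Cconj (q y))%C) in Y.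
    change (Re (Cconj z * (y - z))%C) with (fst (Cconj z * (y - z))%C) in Y.
    assert (0 <= Cmod (q y) ^ 2) by (apply pow_le, Cmod_ge_0).
    apply Rnot_lt_le. intros K. nra. }
  assert (D : Rabs (fst (Cconj z * f z * Cconj (q y))%C - n) < - n).
  { apply Rle_lt_trans with (Cmod z * Cmod (f z) * Cmod (q y - C_derive f z)%C).
    - replace (Cmod z * Cmod (f z) * Cmod (q y - C_derive f z)%C) with
        (Cmod (Cconj z * f z * Cconj (q y - C_derive f z))%C)
        by (rewrite !Cmod_mult, !Cmod_conj; reflexivity).
      eapply Rle_trans; [|apply re_le_Cmod]. right. f_equal.
      unfold n, Re. rewrite Cminus_conj. simpl. ring.
    - apply Rlt_div_r in H1; [|exact HA]. unfold A in H1.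
      generalize (Cmod_ge_0 (q y - C_derive f z)%C). lra. }
  apply Rabs_def2 in D. lra.
Qed.

(** * The bound for [f'' / f'] and its equality case *)

Lemma holo_disk_C_derive f : analytic_on_disk f -> holo_disk (C_derive f).
Proof. intros Hf z Hz. now apply analytic_at_holo, analytic_at_derive, Hf. Qed.

Lemma cderiv_ext_disk F G z l : in_disk z -> (forall w, in_disk w -> F w = G w) ->
  cderiv F z l -> cderiv G z l.
Proof.
  intros Hz E. apply cderiv_ext_loc with (1 - Cmod z).
  - unfold in_disk in Hz. lra.
  - intros w Hw. apply E. now apply (in_disk_near z).
Qed.

Lemma C_derive_ext_disk F G z l : in_disk z -> (forall w, in_disk w -> F w = G w) ->
  cderiv G z l -> C_derive F z = l.
Proof.
  intros Hz E H. apply cderiv_C_derive. apply cderiv_ext_disk with G; auto.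
  intros. symmetry. auto.
Qed.

(** With [g z = f z / z], the function [p z = z f' z / f z] is [f' / g]; in
    this form it is visibly holomorphic at 0. *)
Lemma starlike_factorization f : normalized_starlike f ->
  exists g p : C -> C,
    holo_disk g /\ holo_disk p /\ g (RtoC 0) = RtoC 1 /\ p (RtoC 0) = RtoC 1 /\
    (forall z, in_disk z -> g z <> RtoC 0) /\
    (forall z, f z = (z * g z)%C) /\
    (forall z, in_disk z -> C_derive f z = (p z * g z)%C) /\
    (forall z, in_disk z -> 0 <= fst (p z)).
Proof.
  intros Sf. destruct (Sf) as [Hf [Uf [f0 [f1 _]]]].
  assert (Cf := analytic_holo_disk f Hf).
  set (g := extended_quotient f (RtoC 0) (RtoC 1)).
  assert (g0 : g (RtoC 0) = RtoC 1).
  { unfold g, extended_quotient. destruct (Ceq_dec (RtoC 0) (RtoC 0)); congruence. }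
  assert (Hfg : forall z, f z = (z * g z)%C).
  { intros z. unfold g, extended_quotient. destruct (Ceq_dec z (RtoC 0)) as [->|N]; [rewrite f0; ring|].
    field. replace (z - RtoC 0)%C with z by ring. exact N. }
  assert (Hg : holo_disk g).
  { intros z Hz. destruct (Ceq_dec z (RtoC 0)) as [->|N].
    - apply analytic_at_holo. unfold g. rewrite <- f1. apply analytic_at_extended_quotient; auto.
    - apply holo_at_ext_loc with (fun w => f w / w)%C (Cmod z).
      + now apply Cmod_gt_0.
      + intros w Hw. unfold g, extended_quotient. destruct (Ceq_dec w (RtoC 0)) as [->|Nw].
        * rewrite Cmod_minus_sym in Hw. replace (z - RtoC 0)%C with z in Hw by ring. lra.
        * now replace (w - RtoC 0)%C with w by ring.
      + apply holo_at_div; [now apply Cf|apply holo_at_id|exact N]. }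
  assert (Ng : forall z, in_disk z -> g z <> RtoC 0).
  { intros z Hz E. destruct (Ceq_dec z (RtoC 0)) as [->|N].
    - rewrite g0 in E. exact (C1_nz E).
    - apply N, Uf; [exact Hz|exact in_disk_0|]. rewrite Hfg, E, f0. ring. }
  exists g, (fun z => C_derive f z / g z)%C.
  split; [exact Hg|]. split.
  { intros z Hz. apply holo_at_div; auto. now apply holo_disk_C_derive. }
  split; [exact g0|]. split; [rewrite f1, g0; field; exact C1_nz|].
  split; [exact Ng|]. split; [exact Hfg|]. split.
  { intros z Hz. field. auto. }
  intros z Hz. assert (N := Ng z Hz).
  assert (G2 : 0 < Cmod (g z) ^ 2) by (apply pow_lt; now apply Cmod_gt_0).
  assert (E : (RtoC (Cmod (g z) ^ 2) * (C_derive f z / g z) = Cconj (g z) * C_derive f z)%C).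
  { rewrite Cmod2_conj. field. exact N. }
  apply (f_equal Re) in E. rewrite re_scal_l in E.
  apply Rnot_lt_le. intros K. change (fst (C_derive f z / g z)%C) with
    (Re (C_derive f z / g z)%C) in K.
  assert (L : Re (Cconj (g z) * C_derive f z)%C < 0) by (rewrite <- E; nra).
  destruct (Ceq_dec z (RtoC 0)) as [->|Nz].
  - rewrite g0, f1 in L. simpl in L. lra.
  - assert (X := starlike_Re_nonneg f z Sf Hz).
    assert (Z2 : 0 < Cmod z ^ 2) by (apply pow_lt; now apply Cmod_gt_0).
    assert (Y : (Cconj z * f z * Cconj (C_derive f z) =
        RtoC (Cmod z ^ 2) * Cconj (Cconj (g z) * C_derive f z))%C).
    { rewrite Cmod2_conj, Cmult_conj, Cconj_conj, Hfg. ring. }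
    apply (f_equal Re) in Y. rewrite re_scal_l, re_conj in Y.
    change (fst (Cconj z * f z * Cconj (C_derive f z))%C) with
      (Re (Cconj z * f z * Cconj (C_derive f z))%C) in X. nra.
Qed.

Lemma cderiv_id_mult v : ccont v (RtoC 0) -> cderiv (fun w => w * v w)%C (RtoC 0) (v (RtoC 0)).
Proof. intros H. exists v. split; [intros; ring|]. auto. Qed.

Lemma Cmod_le_shift_of_Re x : 0 <= fst x -> Cmod (x - RtoC 1)%C <= Cmod (x + RtoC 1)%C.
Proof.
  intros H. apply Rsqr_incr_0_var; [|apply Cmod_ge_0].
  rewrite !Rsqr_pow2, !Cmod2_alt. destruct x as [a b]. simpl in *. nra.
Qed.

(** The function [s] is defined by [p = (1 + z s) / (1 - z s)], equivalently
    [z s = (p - 1) / (p + 1)], whose right-hand side falls under Schwarz's lemma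
    since [Re p >= 0]. *)
Lemma starlike_schwarz_quotient g p :
  holo_disk g -> holo_disk p -> g (RtoC 0) = RtoC 1 -> p (RtoC 0) = RtoC 1 ->
  (forall z, in_disk z -> 0 <= fst (p z)) ->
  (forall z, in_disk z -> (z * C_derive g z = (p z - RtoC 1) * g z)%C) ->
  exists s : C -> C,
    (forall z, in_disk z -> Cmod (s z) <= 1) /\
    (forall z, in_disk z ->
       (C_derive g z * (RtoC 1 - z * s z) = RtoC 2 * s z * g z)%C) /\
    (forall z, in_disk z -> Cmod (s z) = 1 -> forall w, in_disk w -> s w = s z).
Proof.
  intros Hg Hp g0 p0 Rp Hgp.
  assert (Np : forall z, in_disk z -> (p z + RtoC 1)%C <> RtoC 0).
  { intros z Hz E. apply (f_equal fst) in E. simpl in E. generalize (Rp z Hz). lra. }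
  set (om := fun z => ((p z - RtoC 1) / (p z + RtoC 1))%C).
  assert (Hom : holo_disk om).
  { intros z Hz. apply holo_at_div; [| |now apply Np].
    - apply holo_at_minus; [now apply Hp|apply holo_at_const].
    - apply holo_at_plus; [now apply Hp|apply holo_at_const]. }
  assert (N2 : (RtoC 1 + RtoC 1)%C <> RtoC 0).
  { intros E. apply (f_equal fst) in E. simpl in E. lra. }
  assert (om0 : om (RtoC 0) = RtoC 0) by (unfold om; rewrite p0; field; exact N2).
  assert (om1 : forall z, in_disk z -> Cmod (om z) <= 1).
  { intros z Hz. unfold om. rewrite Cmod_div by now apply Np.
    apply Rle_div_l; [apply Cmod_gt_0; now apply Np|].
    rewrite Rmult_1_l. now apply Cmod_le_shift_of_Re, Rp. }
  assert (Lom := schwarz om Hom om0 om1).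
  set (s := extended_quotient om (RtoC 0) (C_derive om (RtoC 0))).
  assert (s0 : s (RtoC 0) = C_derive om (RtoC 0)).
  { unfold s, extended_quotient. destruct (Ceq_dec (RtoC 0) (RtoC 0)); congruence. }
  assert (sz : forall z, om z = (z * s z)%C).
  { intros z. unfold s, extended_quotient. destruct (Ceq_dec z (RtoC 0)) as [->|N]; [rewrite om0; ring|].
    field. replace (z - RtoC 0)%C with z by ring. exact N. }
  destruct (holo_at_derive p (RtoC 0) (Hp _ in_disk_0)) as [Dp _].
  assert (om'0 : C_derive om (RtoC 0) = (C_derive p (RtoC 0) / RtoC 2)%C).
  { apply cderiv_C_derive.
    assert (X := cderiv_mult (fun z => p z + - RtoC 1)%C (fun z => / (p z + RtoC 1))%C _ _ _
      (cderiv_plus _ _ _ _ _ Dp (cderiv_const (- RtoC 1)%C (RtoC 0)))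
      (cderiv_inv _ _ _ (cderiv_plus _ _ _ _ _ Dp (cderiv_const (RtoC 1) (RtoC 0)))
         (Np _ in_disk_0))).
    cbv beta in X. rewrite p0 in X.
    match type of X with cderiv _ _ ?l =>
      replace (C_derive p (RtoC 0) / RtoC 2)%C with l; [exact X|] end.
    field. }
  assert (g'0 : C_derive g (RtoC 0) = C_derive p (RtoC 0)).
  { destruct (holo_at_derive g (RtoC 0) (Hg _ in_disk_0)) as [Dg Cg].
    apply (cderiv_unique (fun z => z * C_derive g z)%C (RtoC 0)).
    - apply cderiv_id_mult. exact Cg.
    - apply (cderiv_ext_disk (fun z => (p z + - RtoC 1) * g z)%C); [exact in_disk_0| |].
      + intros w Hw. symmetry. now apply Hgp.
      + replace (C_derive p (RtoC 0)) with
          ((C_derive p (RtoC 0) + RtoC 0) * g (RtoC 0) +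
            (p (RtoC 0) + - RtoC 1) * C_derive g (RtoC 0))%C
          by (rewrite p0, g0; ring).
        apply (cderiv_mult (fun z => p z + - RtoC 1)%C g); [|exact Dg].
        apply cderiv_plus; [exact Dp|apply cderiv_const]. }
  assert (s1 : forall z, in_disk z -> Cmod (s z) <= 1).
  { intros z Hz. destruct (Ceq_dec z (RtoC 0)) as [->|N].
    - rewrite s0, om'0, (Cmod_div_RtoC _ 2) by lra.
      assert (X := derivative_le_Re p (RtoC 0) Hp Rp in_disk_0).
      rewrite p0, Cmod_0 in X. simpl in X. lra.
    - assert (P : 0 < Cmod z) by now apply Cmod_gt_0.
      assert (X := Lom z Hz). rewrite sz, Cmod_mult in X. nra. }
  exists s. split; [exact s1|]. split.
  - intros z Hz. destruct (Ceq_dec z (RtoC 0)) as [->|N].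
    + rewrite g'0, s0, om'0, g0. field.
    + assert (X := Hgp z Hz). assert (Y : ((p z + RtoC 1) * om z = p z - RtoC 1)%C)
        by (unfold om; field; now apply Np).
      rewrite sz in Y.
      (* [p - 1 = (p + 1) z s] and [(p - 1) (1 - z s) = 2 z s] *)
      assert (Y2 : ((p z - RtoC 1) * (RtoC 1 - z * s z) = RtoC 2 * (z * s z))%C).
      { replace (RtoC 2) with (RtoC 1 + RtoC 1)%C by (rewrite <- RtoC_plus; f_equal; ring).
        transitivity ((p z - RtoC 1) - (p z + RtoC 1) * (z * s z)
           + (RtoC 1 + RtoC 1) * (z * s z))%C; [ring|].
        rewrite Y. ring. }
      transitivity (z * C_derive g z * (RtoC 1 - z * s z) / z)%C; [field; exact N|].
      rewrite X.
      transitivity ((p z - RtoC 1) * (RtoC 1 - z * s z) * g z / z)%C; [field; exact N|].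
      rewrite Y2. field. exact N.
  - intros z Hz Hs1.
    assert (R : forall w, in_disk w -> om w = (s z * w)%C).
    { apply (schwarz_rigid om z (s z) Hom om0 om1 Hz Hs1).
      destruct (Ceq_dec z (RtoC 0)) as [->|N]; [left|right]; split; auto.
      rewrite sz. ring. }
    intros w Hw. destruct (Ceq_dec w (RtoC 0)) as [->|N].
    + rewrite s0. apply (C_derive_ext_disk om (fun w => s z * w)%C); auto using in_disk_0.
      apply cderiv_scal.
    + assert (X := R w Hw). rewrite sz in X.
      transitivity (w * s w / w)%C; [field; exact N|]. rewrite X. field. exact N.
Qed.

Lemma Cexp_i_surj c : Cmod c = 1 -> exists theta, c = Cexp_i theta.
Proof.
  intros H. assert (X := Cmod2_alt c). rewrite H in X. destruct c as [x y]. simpl in X.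
  assert (Hx : -1 <= x <= 1) by nra.
  assert (S : sqrt (1 - x ^ 2) = Rabs y).
  { rewrite <- sqrt_Rsqr_abs. f_equal. unfold Rsqr. simpl. lra. }
  assert (S' : sin (acos x) = Rabs y).
  { rewrite sin_acos by exact Hx. rewrite <- S. f_equal. unfold Rsqr. simpl. ring. }
  destruct (Rle_dec 0 y) as [P|P].
  - exists (acos x). unfold Cexp_i.
    rewrite cos_acos, S', Rabs_pos_eq by lra. reflexivity.
  - exists (- acos x). unfold Cexp_i. rewrite cos_neg, sin_neg.
    rewrite cos_acos, S', Rabs_left by lra. f_equal. ring.
Qed.

Lemma one_minus_neq0 c z : Cmod c <= 1 -> in_disk z -> (RtoC 1 - c * z)%C <> RtoC 0.
Proof.
  intros Hc Hz H. apply (f_equal Cmod) in H. rewrite Cmod_0 in H.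
  generalize (Cmod_rev_triangle (RtoC 1) (c * z)%C). rewrite Cmod_mult, Cmod_1.
  unfold in_disk in Hz. generalize (Cmod_ge_0 z) (Cmod_ge_0 c). nra.
Qed.

Lemma cderiv_one_minus c z : cderiv (fun w => RtoC 1 - c * w)%C z (- c)%C.
Proof.
  exists (fun _ => - c)%C. split; [intros; ring|]. split; [reflexivity|].
  apply ccont_const.
Qed.

(** The equation [g' (1 - c z) = 2 c g] says that [g (1 - c z)^2] has
    derivative 0. *)
Lemma koebe_ode g c : holo_disk g -> g (RtoC 0) = RtoC 1 ->
  (forall z, in_disk z -> (C_derive g z * (RtoC 1 - z * c) = RtoC 2 * c * g z)%C) ->
  forall z, in_disk z -> (g z * ((RtoC 1 - c * z) * (RtoC 1 - c * z)) = RtoC 1)%C.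
Proof.
  intros Hg g0 H z Hz.
  set (h := fun z => (g z * ((RtoC 1 - c * z) * (RtoC 1 - c * z)))%C).
  assert (E : h z = h (RtoC 0)).
  { apply (constant_of_derive_0 h (RtoC 0) 1).
    - intros w Hw. replace (w - RtoC 0)%C with w in Hw by ring.
      assert (X := cderiv_mult _ _ _ _ _ (proj1 (holo_at_derive g w (Hg w Hw)))
        (cderiv_mult _ _ _ _ _ (cderiv_one_minus c w) (cderiv_one_minus c w))).
      match type of X with cderiv _ _ ?l => replace (RtoC 0) with l; [exact X|] end.
      transitivity ((C_derive g w * (RtoC 1 - w * c) - RtoC 2 * c * g w)
          * (RtoC 1 - c * w))%C.
      + replace (RtoC 2) with (RtoC 1 + RtoC 1)%C by (rewrite <- RtoC_plus; f_equal; ring).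
        ring.
      + rewrite H by exact Hw. ring.
    - replace (z - RtoC 0)%C with z by ring. exact Hz. }
  change (h z = RtoC 1). rewrite E. unfold h. rewrite g0. ring.
Qed.

Lemma koebe_second_derivative f theta :
  (forall z, in_disk z -> f z = koebe_rotation theta z) ->
  C_derive (C_derive f) (RtoC 0) = (RtoC 4 * Cexp_i theta)%C.
Proof.
  intros H. set (c := Cexp_i theta).
  assert (Hc : Cmod c <= 1) by (unfold c; rewrite Cmod_Cexp_i; lra).
  set (k := fun w => (RtoC 1 - c * w)%C). set (u := fun w => (/ (k w * k w))%C).
  set (v := fun w => (- (- c * k w + k w * - c) * (u w * u w))%C).
  assert (Nk : forall w, in_disk w -> k w <> RtoC 0) by (intros; now apply one_minus_neq0).
  assert (Du : forall w, in_disk w -> cderiv u w (v w)).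
  { intros w Hw. apply (cderiv_inv (fun w => k w * k w)%C).
    - apply cderiv_mult; apply cderiv_one_minus.
    - apply Cmult_neq_0; auto. }
  assert (D1 : forall w, in_disk w -> C_derive f w = (u w + w * v w)%C).
  { intros w Hw.
    apply (C_derive_ext_disk f (fun w => w * u w)%C); [exact Hw|exact H|].
    replace (u w + w * v w)%C with (RtoC 1 * u w + w * v w)%C by ring.
    apply (cderiv_mult (fun w => w)); [apply cderiv_id|now apply Du]. }
  apply (C_derive_ext_disk _ (fun w => u w + w * v w)%C); [exact in_disk_0|exact D1|].
  assert (K0 : k (RtoC 0) = RtoC 1) by (unfold k; ring).
  assert (U0 : u (RtoC 0) = RtoC 1) by (unfold u; rewrite K0; field; exact C1_nz).
  assert (V0 : v (RtoC 0) = (RtoC 2 * c)%C).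
  { unfold v. rewrite K0, U0.
    replace (RtoC 2) with (RtoC 1 + RtoC 1)%C by (rewrite <- RtoC_plus; f_equal; ring).
    ring. }
  replace (RtoC 4 * c)%C with (v (RtoC 0) + v (RtoC 0))%C.
  - apply cderiv_plus; [now apply Du, in_disk_0|]. apply cderiv_id_mult.
    assert (Ck : ccont k (RtoC 0)) by (eapply cderiv_ccont, cderiv_one_minus).
    assert (Cu : ccont u (RtoC 0)) by (eapply cderiv_ccont, Du, in_disk_0).
    apply ccont_mult; [|now apply ccont_mult].
    apply ccont_ext_loc with (fun w => RtoC 2 * c * k w)%C 1; [lra| |].
    + intros w _.
      replace (RtoC 2) with (RtoC 1 + RtoC 1)%C by (rewrite <- RtoC_plus; f_equal; ring).
      ring.
    + apply ccont_mult; [apply ccont_const|exact Ck].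
  - rewrite V0. replace (RtoC 4) with (RtoC 2 + RtoC 2)%C by (rewrite <- RtoC_plus; f_equal; ring).
    ring.
Qed.

(** In [f'' = g (p' + p g' / g)] the two terms are bounded by [2 |f'| / (1 - r^2)]
    and [2 |f'| / (1 - r)], with [r = |z|]; the second bound is attained only if
    the Schwarz function of [p] is a rotation. *)
Lemma starlike_second_derivative f : normalized_starlike f ->
  forall z, in_disk z ->
    Cmod (C_derive (C_derive f) z) * (1 - Cmod z ^ 2)
      <= Cmod (C_derive f z) * (2 * (2 + Cmod z)) /\
    (Cmod (C_derive (C_derive f) z) * (1 - Cmod z ^ 2)
      = Cmod (C_derive f z) * (2 * (2 + Cmod z)) ->
     exists theta, forall w, in_disk w -> f w = koebe_rotation theta w).
Proof.
  intros Sf z Hz.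
  destruct (starlike_factorization f Sf) as [g [p [Hg [Hp [g0 [p0 [Ng [Hfg [Hf' Rp]]]]]]]]].
  assert (Hgp : forall z, in_disk z -> (z * C_derive g z = (p z - RtoC 1) * g z)%C).
  { intros w Hw.
    assert (X : C_derive f w = (RtoC 1 * g w + w * C_derive g w)%C).
    { apply (C_derive_ext_disk f (fun w => w * g w)%C); auto.
      apply (cderiv_mult (fun w => w)); [apply cderiv_id|].
      now apply holo_at_derive, Hg. }
    rewrite Hf' in X by exact Hw.
    replace ((p w - RtoC 1) * g w)%C with (p w * g w - g w)%C by ring.
    rewrite X. ring. }
  destruct (starlike_schwarz_quotient g p Hg Hp g0 p0 Rp Hgp) as [s [s1 [Hs Rig]]].
  assert (F2 : C_derive (C_derive f) z = (C_derive p z * g z + p z * C_derive g z)%C).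
  { apply (C_derive_ext_disk _ (fun w => p w * g w)%C); auto.
    apply cderiv_mult; apply holo_at_derive; auto. }
  set (r := Cmod z). assert (r0 : 0 <= r) by apply Cmod_ge_0.
  assert (r1 : r < 1) by exact Hz.
  set (x := Cmod (s z)). assert (x0 : 0 <= x) by apply Cmod_ge_0.
  assert (x1 : x <= 1) by (now apply s1).
  set (P := Cmod (p z)). assert (P0 : 0 <= P) by apply Cmod_ge_0.
  set (G := Cmod (g z)). assert (G0 : 0 < G) by (apply Cmod_gt_0; auto).
  set (D := Cmod (C_derive g z)). assert (D0 : 0 <= D) by apply Cmod_ge_0.
  assert (B1 : Cmod (C_derive p z) * (1 - r ^ 2) <= 2 * P).
  { eapply Rle_trans; [now apply derivative_le_Re|].
    apply Rmult_le_compat_l; [lra|]. eapply Rle_trans; [apply Rle_abs|apply re_le_Cmod]. }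
  assert (B2 : D * (1 - r * x) <= 2 * x * G).
  { assert (X := f_equal Cmod (Hs z Hz)).
    rewrite !Cmod_mult, Cmod_R, Rabs_pos_eq in X by lra. fold D x G in X.
    rewrite <- X. apply Rmult_le_compat_l; [exact D0|].
    generalize (Cmod_rev_triangle (RtoC 1) (z * s z)%C).
    rewrite Cmod_1, Cmod_mult. fold r x. lra. }
  assert (rx : r * x <= r) by nra.
  (* [x / (1 - r x) <= 1 / (1 - r)], the gap being proportional to [1 - x]. *)
  assert (B3 : D * (1 - r) <= 2 * G * x).
  { apply Rmult_le_reg_r with (1 - r * x); [lra|].
    apply Rle_trans with (2 * x * G * (1 - r)).
    - replace (D * (1 - r) * (1 - r * x)) with (D * (1 - r * x) * (1 - r)) by ring.
      apply Rmult_le_compat_r; lra.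
    - replace (2 * x * G * (1 - r)) with (2 * G * x * (1 - r)) by ring.
      apply Rmult_le_compat_l; [|lra]. nra. }
  assert (F1 : Cmod (C_derive f z) = P * G) by (rewrite Hf', Cmod_mult; auto).
  assert (T : Cmod (C_derive (C_derive f) z) * (1 - r ^ 2) <=
     P * G * 2 + P * G * 2 * x * (1 + r)).
  { rewrite F2.
    apply Rle_trans with ((Cmod (C_derive p z) * G + P * D) * (1 - r ^ 2)).
    - apply Rmult_le_compat_r; [nra|].
      eapply Rle_trans; [apply Cmod_triangle|]. rewrite !Cmod_mult. apply Rle_refl.
    - assert (X1 : Cmod (C_derive p z) * (1 - r ^ 2) * G <= 2 * P * G)
        by (apply Rmult_le_compat_r; lra).
      assert (X2 : D * (1 - r) * (P * (1 + r)) <= 2 * G * x * (P * (1 + r))).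
      { apply Rmult_le_compat_r; [nra|exact B3]. }
      replace ((Cmod (C_derive p z) * G + P * D) * (1 - r ^ 2)) with
        (Cmod (C_derive p z) * (1 - r ^ 2) * G + D * (1 - r) * (P * (1 + r))) by ring.
      lra. }
  assert (PG : 0 <= P * G) by nra.
  rewrite F1. split.
  - eapply Rle_trans; [exact T|].
    assert (P * G * 2 * x * (1 + r) <= P * G * 2 * 1 * (1 + r)).
    { apply Rmult_le_compat_r; [lra|]. apply Rmult_le_compat_l; lra. }
    lra.
  - intros E. rewrite E in T.
    assert (PG' : 0 < P * G).
    { rewrite <- F1. apply Cmod_gt_0. destruct Sf as [Hf [Uf _]].
      now apply univalent_derive_neq0. }
    assert (X1 : x = 1).
    { apply Rle_antisym; [exact x1|].
      assert (Y : P * G * (2 * (1 + r)) * 1 <= P * G * (2 * (1 + r)) * x) by lra.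
      apply Rmult_le_reg_l in Y; [exact Y|]. apply Rmult_lt_0_compat; lra. }
    destruct (Cexp_i_surj (s z) X1) as [theta Et]. exists theta.
    assert (K : forall w, in_disk w ->
        (g w * ((RtoC 1 - s z * w) * (RtoC 1 - s z * w)) = RtoC 1)%C).
    { apply koebe_ode; auto. intros w Hw.
      rewrite <- (Rig z Hz X1 w Hw). now apply Hs. }
    intros w Hw. unfold koebe_rotation. rewrite <- Et, Hfg.
    assert (N : (RtoC 1 - s z * w)%C <> RtoC 0) by (apply one_minus_neq0; auto).
    transitivity (w * (g w * ((RtoC 1 - s z * w) * (RtoC 1 - s z * w)))
      / ((RtoC 1 - s z * w) * (RtoC 1 - s z * w)))%C; [field; exact N|].
    rewrite K by exact Hw. field. exact N.
Qed.

Theorem proposition4p10 :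
  forall f : C -> C, normalized_starlike f ->
    (forall z : C, in_disk z ->
       Rbar_le (Finite ((1 - Cmod z ^ 2) / (2 + Cmod z)))
               (sphere_dist (pole f z) z)) /\
    ((exists z : C, in_disk z /\
        sphere_dist (pole f z) z = Finite ((1 - Cmod z ^ 2) / (2 + Cmod z)))
     <->
     (exists theta : R, forall z : C, in_disk z ->
        f z = koebe_rotation theta z)).
Proof.
  intros f Sf.
  assert (B := starlike_second_derivative f Sf).
  assert (Dist : forall z, C_derive (C_derive f) z <> RtoC 0 ->
    Cmod (z + RtoC 2 * C_derive f z / C_derive (C_derive f) z - z)%C =
    2 * Cmod (C_derive f z) / Cmod (C_derive (C_derive f) z)).
  { intros z N.
    replace (z + RtoC 2 * C_derive f z / C_derive (C_derive f) z - z)%C with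
      (RtoC 2 * C_derive f z / C_derive (C_derive f) z)%C by ring.
    rewrite Cmod_div, Cmod_mult, Cmod_R, Rabs_pos_eq by (auto; lra). reflexivity. }
  split; [|split].
  - intros z Hz. unfold pole. destruct (Ceq_dec _ _) as [E|N]; [exact I|].
    simpl sphere_dist. rewrite Dist by exact N.
    assert (P : 0 < Cmod (C_derive (C_derive f) z)) by now apply Cmod_gt_0.
    generalize (Cmod_ge_0 z). intros Z0. unfold Rbar_le.
    apply Rle_div_l; [lra|].
    apply Rmult_le_reg_r with (1 := P).
    replace (2 * Cmod (C_derive f z) / Cmod (C_derive (C_derive f) z) * (2 + Cmod z)
      * Cmod (C_derive (C_derive f) z)) with (Cmod (C_derive f z) * (2 * (2 + Cmod z)))
      by (field; lra).
    rewrite Rmult_comm. now apply B.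
  - intros [z [Hz E]]. apply (B z Hz).
    unfold pole in E. destruct (Ceq_dec _ _) as [E'|N]; [discriminate E|].
    simpl sphere_dist in E. rewrite Dist in E by exact N.
    assert (P : 0 < Cmod (C_derive (C_derive f) z)) by now apply Cmod_gt_0.
    generalize (Cmod_ge_0 z). intros Z0.
    assert (E1 : 2 * Cmod (C_derive f z) / Cmod (C_derive (C_derive f) z)
        = (1 - Cmod z ^ 2) / (2 + Cmod z)) by exact (f_equal real E).
    transitivity ((1 - Cmod z ^ 2) / (2 + Cmod z) * (2 + Cmod z)
       * Cmod (C_derive (C_derive f) z)); [field; lra|].
    rewrite <- E1. field. lra.
  - intros [theta H]. exists (RtoC 0). split; [exact in_disk_0|].
    assert (F2 := koebe_second_derivative f theta H).
    destruct Sf as [_ [_ [_ [f1 _]]]].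
    assert (M : Cmod (C_derive (C_derive f) (RtoC 0)) = 4).
    { rewrite F2, Cmod_mult, Cmod_R, Cmod_Cexp_i, Rabs_pos_eq; lra. }
    unfold pole. destruct (Ceq_dec _ _) as [E|N].
    + rewrite E, Cmod_0 in M. lra.
    + simpl sphere_dist. rewrite Dist by exact N. rewrite M, f1, Cmod_1, Cmod_0.
      f_equal. field.
Qed.
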